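(* For every partition $\lambda$ and $n\ge0$, $g^{(\alpha,\beta)}_\lambda(x_1,\ldots,x_n,x)=\sum_\mu g^{(\alpha,\beta)}_\mu(x_1,\ldots,x_n)\,g^{(\alpha,\beta)}_{\lambda/\mu}(x)$, where for a single variable $x$, $g^{(\alpha,\beta)}_{\lambda/\mu}(x)=\beta^{r(\lambda/\mu)-b(\lambda/\mu)}(\alpha+\beta)^{i(\lambda/\mu)}x^{b(\lambda/\mu)}(x+\alpha)^{c(\lambda/\mu)-b(\lambda/\mu)}$ if $\mu\subseteq\lambda$, and $g^{(\alpha,\beta)}_{\lambda/\mu}(x)=0$ otherwise.
   Context: Let $\alpha,\beta$ be indeterminates, $\Lambda$ the ring of symmetric functions over $\mathbb{Z}[\alpha,\beta]$, $\hat\Lambda$ its completion, $\langle\cdot,\cdot\rangle:\Lambda\times\hat\Lambda\to\mathbb{Z}[\alpha,\beta]$ the Hall inner product with $\langle s_\lambda,s_\mu\rangle=\delta_{\lambda\mu}$. For a partition $\lambda$ and $n\ge1$, $G^{(\alpha,\beta)}_\lambda(x_1,\ldots,x_n)=\det\Big[\frac{x_i^{\lambda_j+n-j}(1+\beta x_i)^{j-1}}{(1-\alpha x_i)^{\lambda_j}}\Big]_{1\le i,j\le n}\Big/\prod_{i<j}(x_i-x_j)$, stable under $x_{n+1}=0$, defining $G^{(\alpha,\beta)}_\lambda\in\hat\Lambda$. The polynomials $g^{(\alpha,\beta)}_\lambda\in\Lambda$ are defined by $\langle g^{(\alpha,\beta)}_\lambda,G^{(-\alpha,-\beta)}_\mu\rangle=\delta_{\lambda\mu}$;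 $g^{(\alpha,\beta)}_\mu(x_1,\ldots,x_n)$ denotes specialization $x_{n+1}=x_{n+2}=\cdots=0$. For a skew shape $\lambda/\mu$: $r$ = number of nonempty rows, $c$ = number of nonempty columns, $b$ = number of (edge-)connected components, $i(\lambda/\mu)=|\lambda/\mu|-c-r+b$ (for $\mu=\lambda$ all are $0$). *)

(* Defs.v *)
From HB Require Import structures.
From mathcomp Require Import all_boot all_order all_algebra all_fingroup.
From mathcomp Require Import boolp classical_sets cardinality fsbigop.
From mathcomp Require Import mpoly.

Set Implicit Arguments.
Unset Strict Implicit.
Unset Printing Implicit Defensive.

Import GRing.Theory.
Local Open Scope ring_scope.

(* ------------------------------------------------------------------------ *)
(* Partitions: weakly decreasing sequences of positive integers. The part   *)
(* lambda_(j+1) is nth 0 la j, which is 0 for j beyond the length.          *)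
(* ------------------------------------------------------------------------ *)

Definition is_part (s : seq nat) : bool := sorted geq s && (0%N \notin s).

Record intpart := IntPart { parts :> seq nat; _ : is_part parts }.

HB.instance Definition _ := [isSub for parts].
HB.instance Definition _ := [Countable of intpart by <:].

Definition part (la : intpart) (j : nat) : nat := nth 0%N la j.

Definition part_sub (mu la : intpart) : bool :=
  [forall j : 'I_(size mu), (part mu j <= part la j)%N].

(* ------------------------------------------------------------------------ *)
(* Statistics of the skew shape la/mu (used for mu contained in la). A cell *)
(* is a pair (row, column), counted from 0, of the bounding box of la.      *)
(* ------------------------------------------------------------------------ *)

Definition box (la : intpart) : finType :=
  ('I_(size la) * 'I_(head 0%N la))%type.

Definition skew_cells (la mu : intpart) : pred (box la) :=
  [pred z : box la | (part mu z.1 <= z.2 < part la z.1)%N].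
Arguments skew_cells : clear implicits.

Definition consecutive (i j : nat) : bool := (i.+1 == j) || (j.+1 == i).

Definition skew_adj (la mu : intpart) : rel (box la) :=
  [rel z w : box la |
    [&& z \in skew_cells la mu, w \in skew_cells la mu &
        (z.1 == w.1) && consecutive z.2 w.2 ||
        (z.2 == w.2) && consecutive z.1 w.1]].
Arguments skew_adj : clear implicits.

Definition skew_size (la mu : intpart) : nat := #|skew_cells la mu|.

Definition skew_rows (la mu : intpart) : nat :=
  #|[pred i : 'I_(size la) | [exists j, (i, j) \in skew_cells la mu]]|.

Definition skew_cols (la mu : intpart) : nat :=
  #|[pred j : 'I_(head 0%N la) | [exists i, (i, j) \in skew_cells la mu]]|.

Definition skew_comps (la mu : intpart) : nat :=
  n_comp (skew_adj la mu) (skew_cells la mu).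

(* A connected skew shape with r rows and c columns has at least r + c - 1  *)
(* cells, so the subtraction is never truncated when mu is contained in la. *)
Definition skew_inner (la mu : intpart) : nat :=
  (skew_size la mu + skew_comps la mu
   - (skew_cols la mu + skew_rows la mu))%N.

(* Distinct components of a skew shape have disjoint sets of rows and       *)
(* disjoint sets of columns, so the exponents r - b and c - b below are not *)
(* truncated.                                                               *)
Definition skew_g (R : comNzRingType) (a b : R) (la mu : intpart) (x : R) : R :=
  if part_sub mu la then
    b ^+ (skew_rows la mu - skew_comps la mu) *
    (a + b) ^+ skew_inner la mu *
    x ^+ skew_comps la mu *
    (x + a) ^+ (skew_cols la mu - skew_comps la mu)
  else 0.

(* ------------------------------------------------------------------------ *)
(* The ring R[[x_1, ..., x_n]] of formal power series.                      *)
(* ------------------------------------------------------------------------ *)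

Record mpseries (n : nat) (R : comNzRingType) :=
  MPSeries { mpscoef :> 'X_{1..n} -> R }.

HB.instance Definition _ n R := gen_eqMixin (mpseries n R).
HB.instance Definition _ n R := gen_choiceMixin (mpseries n R).

Section PowerSeriesRing.
Variables (n : nat) (R : comNzRingType).
Implicit Types f g h : mpseries n R.

Definition mps (p : {mpoly R[n]}) : mpseries n R := MPSeries (fun m => p@_m).

Definition mps_add f g : mpseries n R := MPSeries (fun m => f m + g m).
Definition mps_opp f : mpseries n R := MPSeries (fun m => - f m).
Definition mps_mul f g : mpseries n R := MPSeries (fun m =>
  \sum_(k : 'X_{1..n < (mdeg m).+1, (mdeg m).+1} | m == (k.1 + k.2)%MM)
     f k.1 * g k.2).

Lemma mpsP f g : (forall m, f m = g m) -> f = g.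
Proof. by case: f; case: g => g f /= fg; congr MPSeries; apply: funext. Qed.

Fact mps_addA : associative mps_add.
Proof. by move=> f g h; apply: mpsP => m /=; rewrite addrA. Qed.
Fact mps_addC : commutative mps_add.
Proof. by move=> f g; apply: mpsP => m /=; rewrite addrC. Qed.
Fact mps_add0 : left_id (mps 0) mps_add.
Proof. by move=> f; apply: mpsP => m /=; rewrite mcoeff0 add0r. Qed.
Fact mps_addN : left_inverse (mps 0) mps_opp mps_add.
Proof. by move=> f; apply: mpsP => m /=; rewrite mcoeff0 addNr. Qed.

HB.instance Definition _ := GRing.isZmodule.Build (mpseries n R)
  mps_addA mps_addC mps_add0 mps_addN.

Definition mps_trunc d f : {mpoly R[n]} :=
  \sum_(m : 'X_{1..n < d}) f m *: 'X_[m].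

Lemma mcoeff_trunc d f m : (mdeg m < d)%N -> (mps_trunc d f)@_m = f m.
Proof.
move=> lt_md; rewrite raddf_sum /= (bigD1 (BMultinom lt_md)) //=.
rewrite mcoeffZ mcoeffX eqxx mulr1 big1 ?addr0 // => k ne_k.
by rewrite mcoeffZ mcoeffX -[_ == m](bmeqP k (BMultinom lt_md)) (negPf ne_k) mulr0.
Qed.

Lemma mps_mulE d f g m : (mdeg m < d)%N ->
  mps_mul f g m = (mps_trunc d f * mps_trunc d g)@_m.
Proof.
move=> lt_md; rewrite mcoeffM; apply: eq_bigr => k _.
by rewrite !mcoeff_trunc //; apply: leq_trans lt_md; apply: bmdeg.
Qed.

Lemma eq_mcoeffM (p p' q q' : {mpoly R[n]}) m :
    (forall k, (mdeg k <= mdeg m)%N -> p@_k = p'@_k) ->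
    (forall k, (mdeg k <= mdeg m)%N -> q@_k = q'@_k) ->
  (p * q)@_m = (p' * q')@_m.
Proof.
move=> pp' qq'; rewrite !mcoeffM; apply: eq_bigr => k _.
by rewrite pp' ?qq' // -ltnS bmdeg.
Qed.

Fact mps_mulC : commutative mps_mul.
Proof. by move=> f g; apply: mpsP => m; rewrite !(mps_mulE _ _ (ltnSn _)) mulrC. Qed.

Fact mps_mulA : associative mps_mul.
Proof.
move=> f g h; apply: mpsP => m; rewrite !(mps_mulE _ _ (ltnSn _)).
set d := (mdeg m).+1.
transitivity (mps_trunc d f * (mps_trunc d g * mps_trunc d h))@_m.
  by apply: eq_mcoeffM => // k le_k; rewrite mcoeff_trunc // (mps_mulE _ _ (_ : mdeg k < d)%N).
rewrite mulrA; apply: eq_mcoeffM => // k le_k.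
by rewrite mcoeff_trunc // (mps_mulE _ _ (_ : mdeg k < d)%N).
Qed.

Fact mps_mul1 : left_id (mps 1) mps_mul.
Proof.
move=> f; apply: mpsP => m; rewrite (mps_mulE _ _ (ltnSn _)).
rewrite -[RHS](mcoeff_trunc f (ltnSn (mdeg m))) -[in RHS](mul1r (mps_trunc _ f)).
by apply: eq_mcoeffM => // k le_k; rewrite mcoeff_trunc.
Qed.

Fact mps_mulDl : left_distributive mps_mul mps_add.
Proof.
move=> f g h; apply: mpsP => m /=; rewrite -big_split /=.
by apply: eq_bigr => k _; rewrite mulrDl.
Qed.

Fact mps_one_neq0 : mps 1 != 0.
Proof.
apply/eqP => /(congr1 (fun f : mpseries n R => f 0%MM)) /eqP.
by rewrite /= mcoeff1 mcoeff0 eqxx oner_eq0.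
Qed.

HB.instance Definition _ := GRing.Zmodule_isComNzRing.Build (mpseries n R)
  mps_mulA mps_mulC mps_mul1 mps_mulDl mps_one_neq0.

Definition mps_unit : pred (mpseries n R) := fun f => `[< exists g, g * f = 1 >].
Definition mps_inv f : mpseries n R :=
  if pselect (exists g, g * f = 1) is left h then projT1 (cid h) else f.

Fact mps_mulVr : {in mps_unit, left_inverse 1 mps_inv *%R}.
Proof.
by move=> f /asboolP ef; rewrite /mps_inv; case: pselect => // h; case: cid.
Qed.
Fact mps_unitP f g : g * f = 1 -> mps_unit f.
Proof. by move=> gf; apply/asboolP; exists g. Qed.
Fact mps_inv_out : {in [predC mps_unit], mps_inv =1 id}.
Proof. by move=> f /asboolPn nf; rewrite /mps_inv; case: pselect. Qed.

HB.instance Definition _ := GRing.ComNzRing_hasMulInverse.Build (mpseries n R)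
  mps_mulVr mps_unitP mps_inv_out.

End PowerSeriesRing.

(* ------------------------------------------------------------------------ *)
(* Symmetric functions, as inverse limits along x_(n+1) = 0: an element is  *)
(* the family of its restrictions f(x_1, ..., x_n). On coefficients, the    *)
(* specialization x_(n+1) = 0 keeps the monomials mnmwiden m not involving  *)
(* the last variable. The completion uses arbitrary symmetric power series; *)
(* symmetric functions proper have polynomial restrictions whose degree is  *)
(* bounded uniformly in n.                                                  *)
(* ------------------------------------------------------------------------ *)

Record symseries (R : comNzRingType) := SymSeries {
  symseries_in :> forall n : nat, mpseries n R;
  symseries_sym : forall n (s : 'S_n) (m : 'X_{1..n}),
    symseries_in n [multinom m (s i) | i < n] = symseries_in n m;
  symseries_stable : forall n (m : 'X_{1..n}),
    symseries_in n.+1 (mnmwiden m) = symseries_in n m }.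

Record symfun (R : comNzRingType) := SymFun {
  symfun_in :> forall n : nat, {mpoly R[n]};
  symfun_sym : forall n, symfun_in n \is symmetric;
  symfun_stable : forall n (m : 'X_{1..n}),
    (symfun_in n.+1)@_(mnmwiden m) = (symfun_in n)@_m;
  symfun_bounded : exists d, forall n, (msize (symfun_in n) <= d)%N }.

HB.instance Definition _ R := gen_eqMixin (symseries R).
HB.instance Definition _ R := gen_choiceMixin (symseries R).
HB.instance Definition _ R := gen_eqMixin (symfun R).
HB.instance Definition _ R := gen_choiceMixin (symfun R).

Definition symseries_of (R : comNzRingType) (f : symfun R) : symseries R :=
  @SymSeries R (fun n => mps (f n))
    (fun n s m => msym_coeff m s (symfun_sym f n)) (@symfun_stable R f).

Definition symseries0 (R : comNzRingType) : symseries R :=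
  @SymSeries R (fun n => 0)
    (fun n s m => etrans (mcoeff0 _ _) (esym (mcoeff0 _ _)))
    (fun n m => etrans (mcoeff0 _ _) (esym (mcoeff0 _ _))).

Fact symfun0_bounded (R : comNzRingType) :
  exists d, forall n, (msize (0 : {mpoly R[n]}) <= d)%N.
Proof. by exists 0%N => n; rewrite msize0. Qed.

Definition symfun0 (R : comNzRingType) : symfun R :=
  @SymFun R (fun n => 0) (fun n => rpred0 _)
    (fun n m => etrans (mcoeff0 _ _) (esym (mcoeff0 _ _)))
    (symfun0_bounded R).

(* ------------------------------------------------------------------------ *)
(* Bialternants: the symmetric series whose restriction to n variables is   *)
(* det (M n) / prod_(i < j) (x_i - x_j) for all n >= l, the quotient being  *)
(* the series F with F * prod_(i < j) (x_i - x_j) = det (M n). Restrictions *)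
(* to fewer than l variables follow by x_(n+1) = 0.                         *)
(* ------------------------------------------------------------------------ *)

Definition vandermonde (R : comNzRingType) (n : nat) : mpseries n R :=
  \prod_(i < n) \prod_(j < n | (i < j)%N) (mps 'X_i - mps 'X_j).

Local Open Scope classical_set_scope.

Definition bialternant (R : comNzRingType) (l : nat)
    (M : forall n, 'M[mpseries n R]_n) : symseries R :=
  xget (symseries0 R) [set F : symseries R |
    forall n, (l <= n)%N -> F n * vandermonde R n = \det (M n)].

(* The formulas below hold in n >= size la variables; with fewer variables  *)
(* the determinant would ignore the last parts of la. Indices start at 0,   *)
(* so the exponents n - j and j - 1 become n - j.+1 and j.                  *)
Definition schur (R : comNzRingType) (la : intpart) : symseries R :=
  bialternant (size la) (fun n => \matrix_(i < n, j < n)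
    mps 'X_i ^+ (part la j + (n - j.+1))).

Definition grothendieck (R : comNzRingType) (a b : R) (la : intpart) :
    symseries R :=
  bialternant (size la) (fun n => \matrix_(i < n, j < n)
    (mps 'X_i ^+ (part la j + (n - j.+1)) * mps (1 + b *: 'X_i) ^+ j
     / mps (1 - a *: 'X_i) ^+ part la j)).

(* ------------------------------------------------------------------------ *)
(* The Hall pairing of sum_la c_la s_la (a finite sum) with                 *)
(* sum_la d_la s_la (possibly infinite) is sum_la c_la d_la. Each monomial  *)
(* occurs in finitely many Schur functions, so that infinite combinations   *)
(* are finite sums coefficientwise.                                         *)
(* ------------------------------------------------------------------------ *)

Definition schur_expansion (R : comNzRingType) (F : symseries R)
    (c : intpart -> R) : Prop :=
  forall n (m : 'X_{1..n}),
    F n m = \sum_(la \in [set: intpart]) c la * schur R la n m.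

Definition schur_coef (R : comNzRingType) (F : symseries R) : intpart -> R :=
  xget (fun=> 0) [set c : intpart -> R | schur_expansion F c].

Definition hall (R : comNzRingType) (f : symfun R) (F : symseries R) : R :=
  \sum_(la \in [set: intpart])
    schur_coef (symseries_of f) la * schur_coef F la.

Definition dual_grothendieck (R : comNzRingType) (a b : R) (la : intpart) :
    symfun R :=
  xget (symfun0 R) [set f : symfun R |
    forall mu, hall f (grothendieck (- a) (- b) mu) = (la == mu)%:R].

Definition alpha : {mpoly int[2]} := 'X_ord0.
Definition beta : {mpoly int[2]} := 'X_ord_max.

(* Main.v *)
Require Import Defs.
From HB Require Import structures.
From mathcomp Require Import all_boot all_order all_algebra all_fingroup.
From mathcomp Require Import boolp classical_sets fsbigop.
From mathcomp Require Import mpoly.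
From mathcomp Require Import zify ring.

Set Implicit Arguments.
Unset Strict Implicit.
Unset Printing Implicit Defensive.

Import GRing.Theory.
Local Open Scope ring_scope.

(** The expansion G_mu = sum_nu M_(mu,nu) s_nu of the Grothendieck functions at
    (-alpha, -beta) has for M_(mu,nu) a determinant of coefficients of the
    one-variable functions in the bialternant. M is unitriangular for the size
    of partitions, so the dual functions are g_la = sum_nu (M^-1)_(nu,la) s_nu,
    and with S(y) the matrix of horizontal strips, which describes the branching
    of Schur polynomials, the theorem becomes the matrix identity
    G(y) M = M S(y), where G(y)_(mu,la) = g_(la/mu)(y).

    The weight g_(la/mu)(y) is a product over the rows of la/mu, the factor of
    row j depending only on la_j, mu_j and mu_(j-1). Summing by multilinearity
    over la_1, la_2, ... independently, column j of the determinant becomes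
    f_j + c_j f_(j-1), where f_j is column j of G_mu divided by 1 - x y, and the
    terms with la_j > la_(j-1) cancel because they add up to a multiple of column
    j - 1. Row operations on det[f_j] produce the other side. *)

(** * Partitions *)

(** For a part of length k, column j holds x^(k+n-1-j) (1 - be x)^j / (1 + al x)^k. Raising k
    multiplies this by x/(1 + al x); raising j and k together multiplies it by (1 - be x)/(1 + al x)
    = 1 - (al + be) x/(1 + al x). Up to k = mu_(j-1) the first relation makes the weighted sum over
    k telescope with ratio y + al; beyond, the second makes it telescope with ratio al + be. This is
    where the cases of the row weight come from. The sums over k are cut off at a bound t above
    every exponent at which a coefficient is taken; the column function of a part t has order at
    least t, so the remainders vanish there. The functions of the statement are chosen by their
    defining properties, so each has to be shown unique. Two facts achieve this: the Vandermonde
    product is regular in the ring of power series, and the coefficient of x^(nu+delta), delta =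
    (n-1, ..., 0), in the product of sum_ka c_ka s_ka with it is c_nu. *)

Lemma part_leS (la : intpart) j : (part la j.+1 <= part la j)%N.
Proof.
have /andP [la_sorted _] := valP la; rewrite /part.
have [lt_j|le_j] := ltnP j.+1 (size la); last by rewrite nth_default.
exact: (sortedP 0%N la_sorted).
Qed.

Lemma part_le (la : intpart) i j : (i <= j)%N -> (part la j <= part la i)%N.
Proof.
move=> /subnK <-; elim: (j - i)%N => // k IHk.
by rewrite addSn; apply: leq_trans (part_leS _ _) IHk.
Qed.

Lemma part_pos (la : intpart) j : (0 < part la j)%N = (j < size la)%N.
Proof.
have [lt_j|le_j] := ltnP j (size la); last by rewrite /part nth_default.
have /andP [_ la_pos] := valP la; rewrite lt0n /part.
by apply: contraTneq (mem_nth 0%N lt_j) => ->.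
Qed.

Lemma part_default (la : intpart) j : (size la <= j)%N -> part la j = 0%N.
Proof. by move=> le_j; rewrite /part nth_default. Qed.

Lemma size_le_part (la : intpart) j : (size la <= j)%N = (part la j == 0%N).
Proof. by rewrite leqNgt -part_pos -eqn0Ngt. Qed.

Lemma intpartP (la mu : intpart) : (forall j, part la j = part mu j) -> la = mu.
Proof.
move=> eq_parts; apply: val_inj => /=; apply: (@eq_from_nth _ 0%N).
  by apply/eqP; rewrite eqn_leq !size_le_part eq_parts -size_le_part leqnn
    -eq_parts -size_le_part leqnn.
by move=> j _; apply: eq_parts.
Qed.

Definition part0 : intpart := @IntPart [::] isT.

Definition psize (la : intpart) : nat := sumn la.

Lemma psizeE (la : intpart) n : (size la <= n)%N ->
  psize la = (\sum_(i < n) part la i)%N.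
Proof.
move=> le_n; rewrite /psize sumnE (big_nth 0%N) big_mkord.
rewrite (big_ord_widen n (fun i => nth 0%N la i) le_n) big_mkcond /=.
by apply: eq_bigr => i _; case: ltnP => // le_i; rewrite part_default.
Qed.

Lemma part_le_psize (la : intpart) j : (part la j <= psize la)%N.
Proof.
have [le_j|lt_j] := leqP (size la) j; first by rewrite part_default.
by rewrite (psizeE (leqnn _)) (bigD1 (Ordinal lt_j)) //= leq_addr.
Qed.

Lemma size_le_psize (la : intpart) : (size la <= psize la)%N.
Proof.
rewrite (psizeE (leqnn _)) -[X in (X <= _)%N]card_ord -sum1_card.
by apply: leq_sum => i _; rewrite part_pos.
Qed.

Definition nonincr n (f : nat -> nat) : Prop :=
  forall i, (i.+1 < n)%N -> (f i.+1 <= f i)%N.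

(** The sequence is cut at its first zero because parts are positive; for a nonincreasing [f] only
    zeros are lost. *)
Definition mkpart n (f : nat -> nat) : intpart :=
  insubd part0 (take (find (pred1 0%N) (mkseq f n)) (mkseq f n)).

Lemma nonincr_le n f i j : nonincr n f ->
  (i <= j)%N -> (j < n)%N -> (f j <= f i)%N.
Proof.
move=> dec_f /subnK <-; elim: (j - i)%N => // k IHk; rewrite addSn => lt_n.
by apply: leq_trans (dec_f _ lt_n) (IHk (ltnW lt_n)).
Qed.

Lemma part_mkpart n f j : nonincr n f ->
  part (mkpart n f) j = if (j < n)%N then f j else 0%N.
Proof.
move=> dec_f; set s := mkseq f n; set k := find (pred1 0%N) s.
have le_k : (k <= n)%N by rewrite -(size_mkseq f n); apply: find_size.
have s_part : is_part (take k s).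
  apply/andP; split.
    apply: take_sorted; apply/(sortedP 0%N) => i; rewrite size_mkseq => lt_i.
    by rewrite !nth_mkseq ?(ltnW lt_i) //; apply: dec_f.
  apply/negP => /(nthP 0%N) [i]; rewrite size_take_min size_mkseq => lt_i.
  rewrite nth_take; last lia.
  by move=> eq0; have := @before_find _ 0%N (pred1 0%N) s i; rewrite /= eq0 -/k; lia.
rewrite /part /mkpart /= insubdK //.
have [lt_k|le_j] := ltnP j k.
  by rewrite nth_take // nth_mkseq ?(leq_trans lt_k) // ifT //; apply: leq_trans le_k.
rewrite nth_default; last by rewrite size_take_min (leq_trans (geq_minl _ _)).
case: ifP => // lt_j; apply/esym/eqP; rewrite -leqn0.
have lt_kn : (k < n)%N by lia.
have : has (pred1 0%N) s by rewrite has_find size_mkseq.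
move/(nth_find 0%N); rewrite -/k nth_mkseq //= => /eqP <-.
exact: nonincr_le lt_j.
Qed.

Definition natfun n t (f : {ffun 'I_n -> 'I_t}) (j : nat) : nat :=
  if insub j is Some o then val (f o) else 0%N.

Lemma natfunE n t (f : {ffun 'I_n -> 'I_t}) (o : 'I_n) : natfun f o = f o.
Proof. by rewrite /natfun valK. Qed.

Lemma natfunEout n t (f : {ffun 'I_n -> 'I_t}) j : (n <= j)%N -> natfun f j = 0%N.
Proof. by move=> le_j; rewrite /natfun insubF // ltnNge le_j. Qed.

(** Only the first [k] values are constrained: [k] is the stage of an induction that imposes the
    partition condition row by row. *)
Definition nonincrb k n t (f : {ffun 'I_n -> 'I_t}) : bool :=
  [forall i : 'I_n, forall j : 'I_n, (i.+1 == j) && (j < k)%N ==> (f j <= f i)%N].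

Lemma nonincrbP k n t (f : {ffun 'I_n -> 'I_t}) : (k <= n)%N ->
  reflect (nonincr k (natfun f)) (nonincrb k f).
Proof.
move=> le_kn; apply: (iffP forallP) => [dec i lt_i|dec i].
  have lt_in := leq_trans lt_i le_kn.
  have := forallP (dec (Ordinal (ltnW lt_in))) (Ordinal lt_in) => /=.
  rewrite eqxx lt_i /=.
  by rewrite -(natfunE f (Ordinal lt_in)) -(natfunE f (Ordinal (ltnW lt_in))).
apply/forallP => j; apply/implyP => /andP [/eqP eq_j lt_j].
by rewrite -!natfunE -eq_j; apply: dec; rewrite eq_j.
Qed.

Definition ffun_part n t (f : {ffun 'I_n -> 'I_t}) : intpart :=
  mkpart n (natfun f).

Lemma part_ffun_part n t (f : {ffun 'I_n -> 'I_t}) j :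
  nonincrb n f -> part (ffun_part f) j = natfun f j.
Proof.
move/(nonincrbP _ (leqnn n)) => dec_f; rewrite part_mkpart //.
by case: ltnP => // le_j; rewrite natfunEout.
Qed.

Definition pbox n t : seq intpart :=
  [seq ffun_part f | f <- enum [pred f : {ffun 'I_n -> 'I_t.+1} | nonincrb n f]].

Lemma pbox_uniq n t : uniq (pbox n t).
Proof.
rewrite map_inj_in_uniq ?enum_uniq // => f g; rewrite !mem_enum => f_dec g_dec eq_fg.
apply/ffunP => o; apply: val_inj => /=.
by rewrite -!natfunE -!part_ffun_part // eq_fg.
Qed.

Lemma mem_pbox n t (la : intpart) :
  (la \in pbox n t) = (size la <= n)%N && (part la 0 <= t)%N.
Proof.
apply/mapP/andP => [[f]|[le_n le_t]].
  rewrite mem_enum => f_dec ->; rewrite size_le_part !part_ffun_part //.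
  rewrite natfunEout //; split=> //; rewrite /natfun; case: insub => // o.
  by rewrite -ltnS ltn_ord.
have lt_t j : (part la j < t.+1)%N by rewrite ltnS (leq_trans (part_le _ (leq0n _))).
pose f : {ffun 'I_n -> 'I_t.+1} := [ffun j : 'I_n => Ordinal (lt_t j)].
have fE : natfun f =1 part la.
  move=> j; have [le_j|lt_j] := leqP n j.
    by rewrite natfunEout // part_default // (leq_trans le_n).
  by rewrite -[j]/(val (Ordinal lt_j)) natfunE ffunE.
exists f.
  by rewrite mem_enum; apply/(nonincrbP _ (leqnn n)) => i _; rewrite !fE part_leS.
apply: intpartP => j; rewrite part_ffun_part //.
by apply/(nonincrbP _ (leqnn n)) => i _; rewrite !fE part_leS.
Qed.

(** A finite index list for sums supported on partitions of size at most [d], all of which it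
    contains. *)
Definition plist d : seq intpart := pbox d d.

Lemma plist_uniq d : uniq (plist d). Proof. exact: pbox_uniq. Qed.

Lemma mem_plist d (la : intpart) : (psize la <= d)%N -> la \in plist d.
Proof.
by move=> le_d; rewrite mem_pbox !(leq_trans _ le_d) ?size_le_psize ?part_le_psize.
Qed.

(** * Finite sums over partitions *)

Section PartitionSums.
Variable V : nmodType.
Implicit Type F : intpart -> V.

Lemma sum_pbox n t F :
  \sum_(la <- pbox n t) F la =
  \sum_(f : {ffun 'I_n -> 'I_t.+1} | nonincrb n f) F (ffun_part f).
Proof. by rewrite big_map big_enum. Qed.

Lemma fsum_seq (r : seq intpart) F : uniq r ->
    (forall la, F la != 0 -> la \in r) ->
  \sum_(la \in [set: intpart]%classic) F la = \sum_(la <- r) F la.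
Proof.
move=> r_uniq supp_r; rewrite [RHS]fsbig_seq //; apply/esym.
apply: fsbig_widen => // la [_ /= notin_r].
by apply/eqP/negPn/negP => /supp_r.
Qed.

Lemma eq_sum_supp (r s : seq intpart) F : uniq r -> uniq s ->
    (forall la, F la != 0 -> la \in r) -> (forall la, F la != 0 -> la \in s) ->
  \sum_(la <- r) F la = \sum_(la <- s) F la.
Proof. by move=> ? ? supp_r supp_s; rewrite -(fsum_seq _ supp_r) // -fsum_seq. Qed.

Lemma sum_delta (r : seq intpart) la (F : intpart -> V) : uniq r -> la \in r ->
    (forall mu, mu != la -> F mu = 0) ->
  \sum_(mu <- r) F mu = F la.
Proof.
move=> r_uniq la_r F0; rewrite (bigD1_seq la) //= big1 ?addr0 //.
Qed.

End PartitionSums.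

(** * Power series in one variable *)

(* A power series in x is its coefficient sequence [nat -> R]; [sh], [mb b]
   and [dv a] multiply it by x, 1 + b x and 1 / (1 - a x). *)
Section Series1.
Variable R : comNzRingType.
Implicit Types (a b y : R) (f g : nat -> R).

Definition sh f (e : nat) : R := if e is e'.+1 then f e' else 0.

Definition mb b f (e : nat) : R := f e + b * sh f e.

Fixpoint dv a f (e : nat) : R := f e + if e is e'.+1 then a * dv a f e' else 0.

Definition d0 (e : nat) : R := (e == 0%N)%:R.

Lemma dvE a f e : dv a f e = f e + a * sh (dv a f) e.
Proof. by case: e => //=; rewrite mulr0. Qed.

Lemma eq_sh f g : f =1 g -> sh f =1 sh g.
Proof. by move=> eq_fg [|e] //=. Qed.

Lemma eq_mb b f g : f =1 g -> mb b f =1 mb b g.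
Proof. by move=> eq_fg e; rewrite /mb eq_fg (eq_sh eq_fg). Qed.

Lemma eq_dv a f g : f =1 g -> dv a f =1 dv a g.
Proof. by move=> eq_fg; elim=> [|e IHe] /=; rewrite ?IHe eq_fg. Qed.

Lemma eq_iter_op (op : (nat -> R) -> nat -> R) k f g :
  (forall f g, f =1 g -> op f =1 op g) -> f =1 g -> iter k op f =1 iter k op g.
Proof. by move=> eq_op eq_fg; elim: k => //= k IHk; apply: eq_op. Qed.

(** The recursion determines a series from degree 0 upwards, so the quotient by 1 - a x is unique;
    the commutation rules of [dv] follow from this. *)
Lemma dvK a f g : (forall e, g e = f e + a * sh g e) -> g =1 dv a f.
Proof.
move=> gE; elim=> [|e IHe]; first by rewrite gE /= mulr0.
by rewrite gE dvE /= IHe.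
Qed.

Lemma sh_mb b f e : sh (mb b f) e = sh f e + b * sh (sh f) e.
Proof. by case: e => [|e] //=; rewrite mulr0 addr0. Qed.

Lemma sh_dvE a f e : sh (dv a f) e = sh f e + a * sh (sh (dv a f)) e.
Proof. by case: e => [|e] /=; rewrite ?mulr0 ?addr0 // dvE. Qed.

Lemma sh_dv a f : sh (dv a f) =1 dv a (sh f).
Proof. by apply: dvK => e; rewrite sh_dvE. Qed.

Lemma mb_dv a b f : mb b (dv a f) =1 dv a (mb b f).
Proof.
by apply: dvK => e; rewrite sh_mb /mb {1}sh_dvE {1}dvE; ring.
Qed.

Lemma iter_sh k f e : iter k sh f e = if (k <= e)%N then f (e - k)%N else 0.
Proof.
elim: k e => [|k IHk] e; first by rewrite subn0.
by case: e => //= e; rewrite IHk ltnS subSS.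
Qed.

(* Coefficients of x^(k + n - 1 - j) (1 + b x)^j / (1 - a x)^k, the function
   in column j of the bialternant in n variables. *)
Definition ser a b n j k : nat -> R :=
  iter (k + (n - j.+1)) sh (iter j (mb b) (iter k (dv a) d0)).

Lemma ser_small a b n j k e : (e < k + (n - j.+1))%N -> ser a b n j k e = 0.
Proof. by move=> lt_e; rewrite /ser iter_sh leqNgt lt_e. Qed.

Lemma ser_lead a b n j k : ser a b n j k (k + (n - j.+1)) = 1.
Proof.
rewrite /ser iter_sh leqnn subnn.
elim: j => [|j IHj] /=; last by rewrite /mb /= mulr0 addr0.
by elim: k => //= k ->; rewrite addr0.
Qed.

Lemma iter_comm (op1 op2 : (nat -> R) -> nat -> R) k f :
    (forall f g, f =1 g -> op1 f =1 op1 g) ->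
    (forall f, op2 (op1 f) =1 op1 (op2 f)) ->
  op2 (iter k op1 f) =1 iter k op1 (op2 f).
Proof.
by move=> eq1 comm; elim: k => //= k IHk e; rewrite comm; apply: eq1.
Qed.

(** Raising [k] multiplies the series by x / (1 - a x); here the denominator is cleared. *)
Lemma sh_ser a b n j k e :
  sh (ser a b n j k) e = ser a b n j k.+1 e - a * sh (ser a b n j k.+1) e.
Proof.
have key e' : ser a b n j k.+1 e' = dv a (sh (ser a b n j k)) e'.
  rewrite /ser addSn iterS -sh_dv; apply: eq_sh => {}e'.
  rewrite [RHS](iter_comm (op2 := dv a) _ _ eq_sh) => [|f e'']; last by rewrite sh_dv.
  apply: eq_iter_op => {}e'; first exact: eq_sh.
  by rewrite [RHS](iter_comm (op2 := dv a) _ _ (@eq_mb b)) // => f e''; rewrite mb_dv.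
by rewrite key dvE -(eq_sh key) addrK.
Qed.

(** Raising [j] trades a factor x for a factor 1 + b x, which the exponent n - 1 - j can spare when
    j + 1 < n. *)
Lemma sh_serS a b n j k e : (j.+1 < n)%N ->
  sh (ser a b n j.+1 k) e = ser a b n j k e + b * sh (ser a b n j k) e.
Proof.
move=> lt_jn; rewrite -/(mb b _ e) /ser.
have -> : (n - j.+1 = (n - j.+2).+1)%N by lia.
rewrite addnS -[sh _ _]/(iter _.+1 sh _ _).
rewrite [RHS](iter_comm (op2 := mb b) _ _ eq_sh) => [|f e']; last by rewrite sh_mb.
by [].
Qed.

End Series1.

(** * Row weights *)

Section RowWeights.
Variables (R : comNzRingType) (al be y : R).

(* The contribution to g_(la/mu)(y) of a row of la of length k, where m is the
   length of the same row of mu and p that of the row of mu just above. *)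
Definition roww (m p k : nat) : R :=
  if (k < m)%N then 0 else
  if k == m then 1 else
  if (k <= p)%N then y * (y + al) ^+ (k - m).-1
  else be * (al + be) ^+ (k - p).-1 * (y + al) ^+ (p - m).

Variable n : nat.
Let phi j k := ser (- al) (- be) n j k.
Let psi j k := dv y (phi j k).

Lemma phi_psi j k e : phi j k e = psi j k e - y * sh (psi j k) e.
Proof. by rewrite {1}/psi dvE addrK. Qed.

Lemma sh_psi j k e : sh (psi j k) e = psi j k.+1 e + al * sh (psi j k.+1) e.
Proof.
rewrite sh_dv; apply/esym; move: e; apply: dvK => e.
have -> : sh (fun e => psi j k.+1 e + al * sh (psi j k.+1) e) e =
   sh (psi j k.+1) e + al * sh (sh (psi j k.+1)) e.
  by case: e => [|e] //=; rewrite mulr0 addr0.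
rewrite /phi sh_ser.
rewrite [X in _ + al * X = _]sh_dvE [X in X + _ = _]dvE -/(psi j k.+1) /phi; ring.
Qed.

Lemma sh_psiS j k e : (j.+1 < n)%N ->
  sh (psi j.+1 k) e = psi j k e - be * sh (psi j k) e.
Proof.
move=> lt_jn; rewrite sh_dv; apply/esym; move: e; apply: dvK => e.
have -> : sh (fun e => psi j k e - be * sh (psi j k) e) e =
   sh (psi j k) e - be * sh (sh (psi j k)) e.
  by case: e => [|e] //=; rewrite mulr0 subr0.
rewrite /phi sh_serS //.
rewrite [X in _ - be * X = _]sh_dvE [X in X - _ = _]dvE -/(psi j k) /phi; ring.
Qed.

(** This is 1 - be x = (1 + al x) - (al + be) x, divided by 1 + al x. Both relations used carry a
    factor x, hence the coefficients at [e.+1]. *)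
Lemma phi_diff j k e : (j.+1 < n)%N ->
  phi j.+1 k.+1 e = phi j k e - (al + be) * phi j k.+1 e.
Proof.
move=> lt_jn; have := sh_serS (- al) (- be) k.+1 e.+1 lt_jn.
have := sh_ser (- al) (- be) n j k e.+1.
by rewrite /= -/(phi _ _) -/(phi _ _) -/(phi _ _) => -> ->; ring.
Qed.

(** Telescoping in [t]: since x psi_t = (1 + al x) psi_(t+1), the remainder absorbs the term at t +
    1 and gains a factor y + al. *)
Lemma sum_roww_below j m p t e : (m <= t <= p)%N ->
  \sum_(k < t.+1) roww m p k * phi j k e =
  psi j m e - y * (y + al) ^+ (t - m) * sh (psi j t) e.
Proof.
case/andP=> /subnK <-; elim: (t - m)%N => [_|d IHd lt_p].
  rewrite add0n subnn expr0 mulr1 big_ord_recr /= big1 => [|k _]; last first.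
    by rewrite /roww ltn_ord mul0r.
  by rewrite /roww ltnn eqxx add0r mul1r phi_psi.
rewrite addSn big_ord_recr /= IHd; last by rewrite (leq_trans _ lt_p) // leq_add2r.
rewrite /roww ltnNge -addSn leq_addl /= lt_p.
have -> : (d.+1 + m == m)%N = false by lia.
rewrite !addnK exprS /= phi_psi addSn [sh (psi j (d + m)) e]sh_psi; ring.
Qed.

(** At t = p this is [sum_roww_below] with its remainder rewritten through column [j]; beyond,
    [phi_diff] makes the remainder gain a factor al + be. The middle term is a multiple of the
    previous column, and the difference of two instances in [t] involves only [phi]. *)
Lemma sum_roww_above j m p t e : (j.+1 < n)%N -> (m <= p <= t)%N ->
  \sum_(k < t.+1) roww m p k * phi j.+1 k e =
  psi j.+1 m e + (be - y) * (y + al) ^+ (p - m) * psi j p e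
  - be * (al + be) ^+ (t - p) * (y + al) ^+ (p - m) * phi j t e.
Proof.
move=> lt_jn /andP [le_mp /subnK <-]; elim: (t - p)%N => [|d IHd].
  rewrite add0n subnn expr0 mulr1 sum_roww_below ?le_mp ?leqnn //.
  by rewrite sh_psiS // phi_psi; ring.
rewrite addSn big_ord_recr /= IHd /roww.
have -> : ((d + p).+1 < m)%N = false by lia.
have -> : ((d + p).+1 == m)%N = false by lia.
have -> : ((d + p).+1 <= p)%N = false by lia.
by rewrite -addSn !addnK addSn phi_diff //= exprS; ring.
Qed.

End RowWeights.

(** * Determinants *)

Section Determinants.
Variable R : comNzRingType.

Lemma det_sum_rows n t (c : 'I_n -> 'I_t -> R) (E : 'I_n -> 'I_t -> 'I_n -> R) :
  \det (\matrix_(i, j) \sum_(k < t) c i k * E i k j) =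
  \sum_(f : {ffun 'I_n -> 'I_t})
    (\prod_i c i (f i)) * \det (\matrix_(i, j) E i (f i) j).
Proof.
rewrite /determinant; under [RHS]eq_bigr do rewrite mulr_sumr.
rewrite exchange_big /=; apply: eq_bigr => s _.
under eq_bigr do rewrite mxE.
rewrite bigA_distr_bigA mulr_sumr; apply: eq_bigr => f _ /=.
rewrite mulrCA -big_split /=; congr (_ * _).
by apply: eq_bigr => i _; rewrite mxE.
Qed.

Lemma det_unitri n (U : 'M[R]_n) :
  (forall i j : 'I_n, (i < j)%N -> U i j = 0) -> (forall i, U i i = 1) -> \det U = 1.
Proof.
move=> U_trig U1; rewrite det_trig; last by apply/is_trig_mxP.
by apply: big1.
Qed.

Lemma sum_ord_pick n (F : 'I_n -> R) (j : 'I_n) :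
  \sum_k F k * (k == j)%:R = F j.
Proof.
rewrite (bigD1 j) //= eqxx mulr1 big1 ?addr0 // => k /negPf ->; exact: mulr0.
Qed.

(** The multiples added are those of the original rows, all at once, so this is multiplication by a
    unitriangular matrix. *)
Lemma det_add_prev n (A : 'I_n -> nat -> R) (c : nat -> R) :
  \det (\matrix_(j < n, i < n) (A i j + if (j : nat) is j'.+1 then c j * A i j' else 0)) =
  \det (\matrix_(j < n, i < n) A i j).
Proof.
pose U := \matrix_(j < n, k < n) ((k == j)%:R + (k.+1 == j)%:R * c j).
suff -> : \matrix_(j < n, i < n) (A i j + if (j : nat) is j'.+1 then c j * A i j' else 0)
    = U *m \matrix_(j < n, i < n) A i j.
  rewrite det_mulmx (@det_unitri _ U) ?mul1r // => [i j lt_ij|i]; rewrite mxE.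
    have -> : (j == i) = false by apply/negP => /eqP eq_ji; move: lt_ij; rewrite eq_ji ltnn.
    have -> : (j.+1 == i :> nat) = false by lia.
    by rewrite mul0r addr0.
  have -> : (i.+1 == i :> nat) = false by lia.
  by rewrite eqxx mul0r addr0.
apply/matrixP => j i; rewrite !mxE.
under eq_bigr do rewrite !mxE mulrDl [_%:R * A _ _]mulrC.
rewrite big_split /= sum_ord_pick; congr (_ + _).
case: j => -[|j'] lt_j /=; first by rewrite big1 // => k _; rewrite !mul0r.
rewrite (bigD1 (Ordinal (ltnW lt_j))) //= eqxx mul1r big1 ?addr0 // => k ne_k.
by rewrite eqSS (negPf (ne_k : (k != j' :> nat))) !mul0r.
Qed.

Lemma det_add_next n (A : 'I_n -> nat -> R) (c : nat -> R) :
  \det (\matrix_(j < n, i < n) (A i j + if (j.+1 < n)%N then c j * A i j.+1 else 0)) =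
  \det (\matrix_(j < n, i < n) A i j).
Proof.
pose U := \matrix_(j < n, k < n) ((k == j)%:R + (j.+1 == k)%:R * c j).
suff -> : \matrix_(j < n, i < n) (A i j + if (j.+1 < n)%N then c j * A i j.+1 else 0)
    = U *m \matrix_(j < n, i < n) A i j.
  rewrite det_mulmx -[\det U]det_tr (@det_unitri _ U^T) ?mul1r // => [i j lt_ij|i]; rewrite !mxE.
    have -> : (i == j) = false by apply/negP => /eqP eq_ji; move: lt_ij; rewrite eq_ji ltnn.
    have -> : (j.+1 == i :> nat) = false by lia.
    by rewrite mul0r addr0.
  have -> : (i.+1 == i :> nat) = false by lia.
  by rewrite eqxx mul0r addr0.
apply/matrixP => j i; rewrite !mxE.
under eq_bigr do rewrite !mxE mulrDl [_%:R * A _ _]mulrC.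
rewrite big_split /= sum_ord_pick; congr (_ + _).
case: ifP => lt_j.
  rewrite (bigD1 (Ordinal lt_j)) //= eqxx mul1r big1 ?addr0 // => k ne_k.
  have -> : (j.+1 == k) = false by apply/negbTE; rewrite eq_sym.
  by rewrite !mul0r.
rewrite big1 // => k _; have -> : (j.+1 == k) = false by have := ltn_ord k; lia.
by rewrite !mul0r.
Qed.

Definition ffun_set n t (f : {ffun 'I_n -> 'I_t}) (o : 'I_n) (k : 'I_t) :=
  [ffun j => if j == o then k else f j].

Lemma ffun_setK n t (f : {ffun 'I_n -> 'I_t}) o k l :
  ffun_set (ffun_set f o k) o l = ffun_set f o l.
Proof. by apply/ffunP => j; rewrite !ffunE; case: eqP. Qed.

Lemma ffun_set_id n t (f : {ffun 'I_n -> 'I_t}) o : ffun_set f o (f o) = f.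
Proof. by apply/ffunP => j; rewrite !ffunE; case: eqP => // ->. Qed.

(* With all other values of f fixed, row o sums to a multiple of row o'. *)
Lemma sum_det_cancel n t (o o' : 'I_n) (Q : pred {ffun 'I_n -> 'I_t.+1})
    (w : 'I_n -> 'I_t.+1 -> R) (E : 'I_n -> 'I_t.+1 -> 'I_n -> R) :
    o' != o -> (forall f k, Q (ffun_set f o k) = Q f) ->
    (forall s : 'I_t.+1, w o' s != 0 -> exists c, forall i,
       \sum_(k < t.+1 | (s < k)%N) w o k * E o k i = c * E o' s i) ->
  \sum_(f : {ffun 'I_n -> 'I_t.+1} | Q f && (f o' < f o)%N)
    (\prod_j w j (f j)) * \det (\matrix_(j, i) E j (f j) i) = 0.
Proof.
move=> ne_o Q_set row_o.
(* Functions are grouped by their values off [o]; setting the value at [o] to [ord0] picks a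
   representative of each group. *)
rewrite (partition_big (fun f => ffun_set f o ord0) predT) //=.
apply: big1 => g _; have [eq_g|ne_g] := eqVneq (ffun_set g o ord0) g; last first.
  rewrite big_pred0 // => f; apply: contraNF ne_g => /andP [_ /eqP <-].
  by rewrite ffun_setK.
rewrite (reindex_onto (fun k => ffun_set g o k) (fun f => f o)) /=; last first.
  by move=> f /andP [_ /eqP <-]; rewrite ffun_setK ffun_set_id.
rewrite (eq_bigl (fun k : 'I_t.+1 => Q g && (g o' < k)%N)); last first.
  move=> k; rewrite Q_set !ffunE eqxx (negPf ne_o) ffun_setK eq_g !eqxx.
  by rewrite !andbT.
case: (Q g); last by rewrite big_pred0.
(* In [A] row [o] is replaced by row [o']: its determinant vanishes, while its cofactors along [o]
   are those of every matrix in the group. *)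
pose A := \matrix_(j, i) E (if j == o then o' else j) (g (if j == o then o' else j)) i.
have detE k : \det (\matrix_(j, i) E j (ffun_set g o k j) i) =
    \sum_i E o k i * cofactor A o i.
  rewrite (expand_det_row _ o); apply: eq_bigr => i _.
  rewrite mxE ffunE eqxx; congr (_ * (_ * \det _)).
  apply/matrixP => a b; rewrite !mxE ffunE.
  by rewrite eq_sym (negPf (neq_lift o a)).
have [w0|w_neq0] := eqVneq (w o' (g o')) 0.
  apply: big1 => k _; rewrite (bigD1 o') //= ffunE (negPf ne_o) w0.
  by rewrite !mul0r.
have [c rowE] := row_o _ w_neq0.
transitivity (\sum_(k < t.+1 | (g o' < k)%N)
    (\prod_(j | j != o) w j (g j)) * \sum_i (w o k * E o k i) * cofactor A o i).
  apply: eq_bigr => k _; rewrite detE (bigD1 o) //= ffunE eqxx.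
  rewrite [w o k * _]mulrC -mulrA mulr_sumr; congr (_ * _).
    by apply: eq_bigr => j /negPf ne_j; rewrite ffunE ne_j.
  by apply: eq_bigr => i _; rewrite mulrA.
rewrite -mulr_sumr exchange_big /=.
suff -> : \sum_i \sum_(k < t.+1 | (g o' < k)%N) w o k * E o k i * cofactor A o i
    = c * \det A.
  have -> : \det A = 0; last by rewrite !mulr0.
  apply: (@determinant_alternate _ _ _ o o'); first by rewrite eq_sym.
  by move=> i; rewrite !mxE eqxx (negPf ne_o).
rewrite (expand_det_row _ o) mulr_sumr; apply: eq_bigr => i _.
by rewrite -mulr_suml rowE [A _ _]mxE eqxx -mulrA.
Qed.

End Determinants.

(** * The transition matrix and the key identity *)

Section Transition.
Variable R : comNzRingType.
Implicit Types a b y : R.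

(** The coefficient of the bialternant of [mu] at the exponents nu + delta, which is again a
    determinant because each matrix entry is a series in a single variable. *)
Definition transn a b n (mu nu : intpart) : R :=
  \det (\matrix_(j < n, i < n) ser a b n j (part mu j) (part nu i + (n - i.+1))).

(** No row lies above row 0; [t] bounds its length, which keeps row 0 in the cases of [roww] without
    overlap. *)
Definition prevpart (mu : intpart) (t j : nat) : nat :=
  if j is j'.+1 then part mu j' else t.

Lemma nonincrb_lt2 n t (f : {ffun 'I_n -> 'I_t}) k : (k <= 1)%N -> nonincrb k f.
Proof.
move=> le_k1; apply/forallP => i; apply/forallP => j; apply/implyP.
by move=> /andP [/eqP <-]; rewrite ltnNge (leq_trans le_k1).
Qed.

Lemma nonincrbS n t (f : {ffun 'I_n -> 'I_t}) k (lt_k : (k.+1 < n)%N) :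
  nonincrb k.+2 f =
  nonincrb k.+1 f && (f (Ordinal lt_k) <= f (Ordinal (ltnW lt_k)))%N.
Proof.
rewrite -!natfunE /=.
apply/(nonincrbP _ lt_k)/andP => [dec|[/(nonincrbP _ (ltnW lt_k)) dec le_k] i].
  split; last exact: dec.
  by apply/(nonincrbP _ (ltnW lt_k)) => i lt_i; apply: dec; apply: ltnW.
by rewrite ltnS leq_eqVlt => /orP [/eqP [->] //|]; apply: dec.
Qed.

Lemma nonincrb_set n t (f : {ffun 'I_n -> 'I_t}) k (o : 'I_n) l :
  (k <= o)%N -> nonincrb k (ffun_set f o l) = nonincrb k f.
Proof.
move=> le_k; apply: eq_forallb => i; apply: eq_forallb => j.
case: (i.+1 =P j) => //= eq_j; case: (ltnP j k) => //= lt_j.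
by rewrite !ffunE !ifF //; apply/negbTE/eqP => eq_o; move: le_k; rewrite -eq_o; lia.
Qed.

Section SkewSum.
Variables (al be y : R) (n t : nat) (mu : intpart) (e : 'I_n -> nat).
Hypotheses (mu_t : (part mu 0 <= t)%N) (e_t : forall i, (e i < t)%N).
Let phi j k := ser (- al) (- be) n j k.
Let w (j k : nat) : R := roww al be y (part mu j) (prevpart mu t j) k.
Let W (f : {ffun 'I_n -> 'I_t.+1}) : R :=
  (\prod_(j < n) w j (f j)) * \det (\matrix_(j < n, i < n) phi j (f j) (e i)).

Let prev_t j : (prevpart mu t j <= t)%N.
Proof. by case: j => //= j; apply: leq_trans (part_le _ (leq0n _)) mu_t. Qed.

Let phi_top j i : phi j t (e i) = 0.
Proof. by apply: ser_small; rewrite (leq_trans (e_t i)) // leq_addr. Qed.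

Let sum_w j i : (j < n)%N ->
  \sum_(k < t.+1) w j k * phi j k (e i) =
  dv y (phi j (part mu j)) (e i) +
  if j is j'.+1 then
    ((be - y) * (y + al) ^+ (part mu j' - part mu j)) * dv y (phi j' (part mu j')) (e i)
  else 0.
Proof.
case: j => [|j] lt_j.
  rewrite sum_roww_below ?mu_t ?leqnn // sh_dv addr0.
  (* [phi 0 t] is divisible by x^t, so after the shift its coefficients vanish up to degree [t], and
     the remainder of [sum_roww_below] drops out. *)
  suff dv0 e' : (e' <= t)%N -> dv y (sh (phi 0 t)) e' = 0.
    by rewrite dv0 ?mulr0 ?subr0 // ltnW.
  elim: e' => [|e' IHe] le_e /=; first by rewrite addr0.
  rewrite IHe ?(ltnW le_e) // mulr0 addr0; apply: ser_small.
  by rewrite (leq_trans le_e) // leq_addr.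
rewrite sum_roww_above ?part_leS ?(prev_t j.+1) //.
by rewrite -/(phi j t) phi_top mulr0 subr0.
Qed.

Lemma sum_all_skew :
  \sum_(f : {ffun 'I_n -> 'I_t.+1}) W f =
  \det (\matrix_(j < n, i < n) dv y (phi j (part mu j)) (e i)).
Proof.
have := det_sum_rows (fun j k => w j (k : 'I_t.+1)) (fun j k i => phi j k (e i)).
move=> /= <-.
rewrite -(det_add_prev (fun i j => dv y (phi j (part mu j)) (e i))
   (fun j => (be - y) * (y + al) ^+ (part mu j.-1 - part mu j))).
congr (\det _); apply/matrixP => j i; rewrite !mxE sum_w //.
by case: (nat_of_ord j).
Qed.

(** The conditions f_(k+1) <= f_k are imposed one at a time from the top. At each stage f_(k+1) is
    still unconstrained, and the functions violating the next condition cancel by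
    [sum_det_cancel]. *)
Lemma sum_nonincr_skew k : (k <= n)%N ->
  \sum_(f : {ffun 'I_n -> 'I_t.+1} | nonincrb k f) W f =
  \det (\matrix_(j < n, i < n) dv y (phi j (part mu j)) (e i)).
Proof.
elim: k => [_|[_ _|k IHk lt_k]].
- by rewrite -sum_all_skew; apply: eq_bigl => f; rewrite nonincrb_lt2.
- by rewrite -sum_all_skew; apply: eq_bigl => f; rewrite nonincrb_lt2.
rewrite -IHk ?(ltnW lt_k) //.
set o := Ordinal lt_k; set o' := Ordinal (ltnW lt_k).
rewrite [RHS](bigID (fun f : {ffun 'I_n -> 'I_t.+1} => (f o <= f o')%N)) /=.
rewrite [X in _ = _ + X](_ : _ = 0) ?addr0.
  by apply: eq_bigl => f; rewrite nonincrbS.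
under eq_bigl do rewrite -ltnNge.
apply: (sum_det_cancel (w := fun j k => w j (k : 'I_t.+1))
  (E := fun j k i => phi j k (e i))).
- by rewrite -val_eqE /=; lia.
- by move=> f l; apply: nonincrb_set.
(* Row weights vanish below [p], so a nonzero one gives [p <= s]. Then [s] and [t] are both
   admissible bounds in [sum_roww_above], and the sum over l > s is the difference of its two
   instances, a multiple of [phi k s]. *)
move=> s; rewrite {1}/w /roww /=; case: ltnP => [|le_s _]; first by rewrite eqxx.
set p := part mu k in le_s *; set m := part mu k.+1.
exists (be * (al + be) ^+ (s - p) * (y + al) ^+ (p - m)) => i.
have le_st : (s <= t)%N by rewrite -ltnS.
have split_sum : \sum_(l < t.+1) w k.+1 l * phi k.+1 l (e i) =
   \sum_(l < s.+1) w k.+1 l * phi k.+1 l (e i) +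
   \sum_(l < t.+1 | (s < l)%N) w k.+1 l * phi k.+1 l (e i).
  rewrite (bigID (fun l : 'I_t.+1 => (s < l)%N)) /= addrC; congr (_ + _).
  rewrite (big_ord_widen t.+1 (fun l => w k.+1 l * phi k.+1 l (e i)) (le_st : (s.+1 <= t.+1)%N)).
  by apply: eq_bigl => l; rewrite -leqNgt.
move: split_sum; rewrite [LHS]sum_roww_above ?part_leS ?(prev_t k.+1) //=.
rewrite [X in _ = X + _]sum_roww_above ?part_leS ?le_s //= -!/(phi _ _) phi_top mulr0 subr0.
by move/(canLR (addKr _)) => <-; rewrite -/p -/m; ring.
Qed.

End SkewSum.

Definition strw y (m' m k : nat) : R :=
  if (m' <= k <= m)%N then y ^+ (m - k) else 0.

(** Subtracting a multiple of a lower coefficient of h / (1 - x y) cuts off the lower end of the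
    geometric sum. *)
Lemma dv_interval y h s (a b : nat) : (a <= b)%N ->
  dv y h (b + s.+1) - y ^+ (b.+1 - a) * dv y h (a + s) =
  \sum_(a <= k < b.+1) y ^+ (b - k) * h (k + s.+1)%N.
Proof.
move/subnK <-; elim: (b - a)%N => [|d IHd].
  by rewrite add0n subSnn big_nat1 subnn expr0 mul1r addnS /= addrK.
rewrite big_nat_recr /=; last lia.
rewrite subnn expr0 mul1r addSn /= -addrA [RHS]addrC; congr (_ + _).
rewrite big_nat_cond (eq_bigr (fun k => y * (y ^+ (d + a - k) * h (k + s.+1)%N))).
  rewrite -big_nat_cond -mulr_sumr -IHd.
  have -> : ((d + a).+2 - a = ((d + a).+1 - a).+1)%N by lia.
  by rewrite exprS; ring.
by move=> k /andP [/andP [_ le_k] _]; rewrite mulrA -exprS -subSn.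
Qed.

Lemma dv_sum y h (b : nat) : dv y h b = \sum_(0 <= k < b.+1) y ^+ (b - k) * h k.
Proof.
elim: b => [|b IHb]; first by rewrite big_nat1 expr0 mul1r /= addr0.
rewrite big_nat_recr //= subnn expr0 mul1r addrC IHb; congr (_ + _).
rewrite mulr_sumr; apply: eq_big_nat => k /andP [_ le_k].
by rewrite mulrA -exprS -subSn.
Qed.

Lemma sum_strw y (a b t : nat) (H : nat -> R) : (b <= t)%N ->
  \sum_(k < t.+1) strw y a b k * H k = \sum_(a <= k < b.+1) y ^+ (b - k) * H k.
Proof.
move=> le_bt; rewrite (@big_nat_widenl _ _ _ a 0) // (@big_nat_widen _ _ _ 0 b.+1 t.+1) //.
rewrite big_mkord [RHS]big_mkcond /=; apply: eq_bigr => k _.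
by rewrite /strw ltnS; case: ifP => // _; rewrite mul0r.
Qed.

(** Subtract y^(nu_i + 1 - nu_(i+1)) times row i + 1 from row i: this is the power by which the
    exponents nu_i + n - 1 - i differ, so a sum over nu_(i+1) <= k <= nu_i is left, the condition of
    a horizontal strip. *)
Lemma det_dv_rows y n t (h : 'I_n -> nat -> R) (nu : intpart) :
    (size nu <= n)%N -> (part nu 0 <= t)%N ->
  \det (\matrix_(j < n, i < n) dv y (h j) (part nu i + (n - i.+1))) =
  \sum_(f : {ffun 'I_n -> 'I_t.+1})
    (\prod_(i < n) strw y (part nu i.+1) (part nu i) (f i)) *
    \det (\matrix_(j < n, i < n) h j (f i + (n - i.+1))%N).
Proof.
move=> le_n le_t; rewrite -det_tr.
under eq_bigr do rewrite -[\det _]det_tr.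
have nu_t i : (part nu i <= t)%N by apply: leq_trans (part_le _ (leq0n _)) le_t.
pose A (j : 'I_n) i := dv y (h j) (part nu i + (n - i.+1)).
transitivity (\det (\matrix_(i < n, j < n) A j i)).
  by congr (\det _); apply/matrixP => i j; rewrite !mxE.
rewrite -(det_add_next _ (fun i => - y ^+ ((part nu i).+1 - part nu i.+1))).
have := det_sum_rows (fun i k => strw y (part nu i.+1) (part nu i) (k : 'I_t.+1))
  (fun i k j => h j (k + (n - i.+1))%N).
set B := \matrix_(i, j) _ => sumE.
transitivity (\det B); last first.
  rewrite sumE; apply: eq_bigr => f _; congr (_ * \det _).
  by apply/matrixP => i j; rewrite !mxE.
congr (\det _); apply/matrixP => i j; rewrite !mxE.
rewrite (sum_strw _ _ (fun k => h j (k + (n - i.+1))%N)) // /A.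
case: ifP => lt_i; last first.
  (* The last row has no successor; as nu_n = 0, its full geometric sum is already the interval
     sum. *)
  have -> : (n - i.+1 = 0)%N by lia.
  rewrite addr0 addn0 (part_default (j := i.+1)); last by lia.
  by rewrite dv_sum; apply: eq_bigr => k _; rewrite addn0.
have -> : (n - i.+1 = (n - i.+2).+1)%N by lia.
by rewrite -dv_interval ?part_leS // mulNr.
Qed.

Definition strip_wt n y (nu ka : intpart) : R :=
  \prod_(i < n) strw y (part nu i.+1) (part nu i) (part ka i).

Definition skew_wt n al be y (la mu : intpart) : R :=
  \prod_(j < n) roww al be y (part mu j) (prevpart mu (part la 0) j) (part la j).

(** Functions that are not partitions have weight 0, since the intervals force f_(i+1) <= nu_(i+1)
    <= f_i. *)
Lemma sum_strip_pbox y n t (nu : intpart) (D : (nat -> nat) -> R) :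
    (forall f g, (forall i, (i < n)%N -> f i = g i) -> D f = D g) ->
  \sum_(f : {ffun 'I_n -> 'I_t.+1})
    (\prod_(i < n) strw y (part nu i.+1) (part nu i) (f i)) * D (natfun f) =
  \sum_(ka <- pbox n t) strip_wt n y nu ka * D (part ka).
Proof.
move=> D_ext; rewrite sum_pbox [RHS]big_mkcond /=; apply: eq_bigr => f _.
case: ifPn => [dec_f|ndec_f].
  congr (_ * _); last by apply: D_ext => i _; rewrite part_ffun_part.
  by apply: eq_bigr => i _; rewrite part_ffun_part // natfunE.
have [i i_bad] : exists i : 'I_n, ~~ (part nu i.+1 <= f i <= part nu i)%N.
  apply/existsP; apply: contraNT ndec_f; rewrite negb_exists => /forallP all_ok.
  apply/(nonincrbP _ (leqnn n)) => i lt_i.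
  have := all_ok (Ordinal lt_i); have := all_ok (Ordinal (ltnW lt_i)).
  rewrite !negbK -!natfunE /= => /andP [ge_i _] /andP [_ le_i].
  exact: leq_trans le_i ge_i.
by rewrite (bigD1 i) //= {1}/strw (negPf i_bad) !mul0r.
Qed.

(** Both sides are the determinant of the columns divided by 1 - x y. The bound [t] exceeds all
    exponents nu_i + n - 1 - i, so parts beyond it could not contribute. *)
Lemma skew_transition al be y n t (mu nu : intpart) :
    (size nu <= n)%N -> (part mu 0 <= t)%N -> (part nu 0 + n < t)%N ->
  \sum_(la <- pbox n t) skew_wt n al be y la mu * transn (- al) (- be) n la nu =
  \sum_(ka <- pbox n t) transn (- al) (- be) n mu ka * strip_wt n y nu ka.
Proof.
move=> le_n mu_t nu_t; pose e (i : 'I_n) := (part nu i + (n - i.+1))%N.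
have e_t i : (e i < t)%N.
  by have := part_le nu (leq0n i); rewrite /e; have := ltn_ord i; lia.
pose phi j k := ser (- al) (- be) n j k.
transitivity (\det (\matrix_(j < n, i < n) dv y (phi j (part mu j)) (e i))).
  rewrite -(sum_nonincr_skew al be y mu_t e_t (leqnn n)) sum_pbox.
  apply: eq_bigr => f dec_f; congr (_ * _); last first.
    by congr (\det _); apply/matrixP => j i; rewrite !mxE part_ffun_part // natfunE.
  apply: eq_bigr => j _; rewrite !part_ffun_part // natfunE.
  (* In row 0 the two weights use the bounds la_0 and [t]; the length exceeds neither, so [roww]
     takes the same value. *)
  case: j => -[|j] lt_j //=; rewrite /roww -[0%N]/(val (Ordinal lt_j)) natfunE.
  by rewrite leqnn (_ : (f _ <= t)%N = true) // -ltnS ltn_ord.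
rewrite (@det_dv_rows _ _ t (fun j => phi j (part mu j))) //; last by lia.
pose D (f : nat -> nat) :=
  \det (\matrix_(j < n, i < n) phi j (part mu j) (f i + (n - i.+1))%N).
rewrite (eq_bigr (fun f : {ffun 'I_n -> 'I_t.+1} =>
  (\prod_(i < n) strw y (part nu i.+1) (part nu i) (f i)) * D (natfun f))).
  rewrite sum_strip_pbox => [|f g eq_fg]; last first.
    by congr (\det _); apply/matrixP => j i; rewrite !mxE eq_fg.
  by apply: eq_bigr => ka _; rewrite mulrC.
move=> f _; congr (_ * \det _); apply/matrixP => j i.
by rewrite !mxE natfunE.
Qed.

End Transition.

(** * Stability and unitriangularity of the transition matrix *)

Section TransitionMatrix.
Variable R : comNzRingType.
Implicit Types a b : R.

(** The added column has exponent 0, where only the added row has a nonzero coefficient, namely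
    1. *)
Lemma transnS a b n (mu nu : intpart) : (size mu <= n)%N -> (size nu <= n)%N ->
  transn a b n.+1 mu nu = transn a b n mu nu.
Proof.
move=> le_mu le_nu; rewrite /transn (expand_det_col _ ord_max).
rewrite (bigD1 ord_max) //= big1 => [|j ne_j]; last first.
  rewrite mxE ser_small ?mul0r // (part_default le_nu) /=.
  by have := ltn_ord j; have : (j != n :> nat) := ne_j; lia.
rewrite mxE !(part_default le_mu) (part_default le_nu) ser_lead mul1r addr0.
rewrite /cofactor -signr_odd oddD addbb expr0 mul1r.
congr (\det _); apply/matrixP => j i; rewrite !mxE !lift_max.
rewrite /ser; have -> : (n.+1 - j.+1 = (n - j.+1).+1)%N by have := ltn_ord j; lia.
have -> : (n.+1 - i.+1 = (n - i.+1).+1)%N by have := ltn_ord i; lia.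
by rewrite !addnS.
Qed.

Definition trans a b (mu nu : intpart) : R :=
  transn a b (maxn (size mu) (size nu)) mu nu.

Lemma transnE a b n (mu nu : intpart) : (size mu <= n)%N -> (size nu <= n)%N ->
  transn a b n mu nu = trans a b mu nu.
Proof.
move=> le_mu le_nu; have le_n : (maxn (size mu) (size nu) <= n)%N by rewrite geq_max le_mu.
rewrite -(subnK le_n); elim: (n - _)%N => // k IHk.
by rewrite addSn transnS // (leq_trans _ (leq_addl _ _)) ?leq_maxl ?leq_maxr.
Qed.

Lemma det_neq0 n (A : 'M[R]_n) : \det A != 0 -> exists s : 'S_n, forall i, A i (s i) != 0.
Proof.
move=> det_n0; suff /existsP [s /forallP] : [exists s : 'S_n, [forall i, A i (s i) != 0]].
  by exists s.
apply: contraR det_n0.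
rewrite negb_exists => /forallP no_s; apply/eqP/big1 => s _.
have := no_s s; rewrite negb_forall => /existsP [i]; rewrite negbK => /eqP Ai0.
by rewrite (bigD1 i) //= Ai0 mul0r mulr0.
Qed.

Lemma card_ord_lt n k : (k <= n)%N -> #|[set i : 'I_n | (i < k)%N]| = k.
Proof.
move=> le_k; rewrite -sum1_card; under eq_bigl do rewrite inE.
by rewrite -(big_ord_widen n (fun=> 1%N) le_k) sum1_card card_ord.
Qed.

(** Pigeonhole: the j + 1 indices up to [j] cannot all be sent below [j]. *)
Lemma perm_reaches n (s : 'S_n) (j : 'I_n) : exists2 i : 'I_n, (i <= j)%N & (j <= s i)%N.
Proof.
case: (pickP (fun i : 'I_n => (i <= j)%N && (j <= s i)%N)) => [i /andP [] *|none].
  by exists i.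
have sub : s @: [set i : 'I_n | (i < j.+1)%N] \subset [set i : 'I_n | (i < j)%N].
  apply/fintype.subsetP => _ /imsetP [i + ->]; rewrite !inE ltnS => le_i.
  by have := none i; rewrite le_i /= leqNgt => /negbFE.
have := subset_leq_card sub; rewrite card_imset; last exact: perm_inj.
by rewrite !card_ord_lt ?ltnn // ltnW.
Qed.

(** Some permutation s has only nonzero entries. For i <= j <= s i, the order of the series in row i
    gives mu_j <= mu_i <= nu_(s i) <= nu_j. *)
Lemma trans_part a b (mu nu : intpart) j :
  trans a b mu nu != 0 -> (part mu j <= part nu j)%N.
Proof.
move=> t_neq0; set n := maxn (size mu) (maxn (size nu) j.+1).
have lt_j : (j < n)%N by rewrite !leq_max leqnn !orbT.
move: t_neq0; rewrite -(@transnE _ _ n) ?leq_max ?leqnn ?orbT //.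
move/det_neq0 => [s s_neq0]; have [i le_i le_si] := perm_reaches s (Ordinal lt_j).
have := s_neq0 i; rewrite mxE; apply: contraR; rewrite -ltnNge => lt_mu.
apply/eqP/ser_small; have := part_le mu le_i; have := part_le nu le_si.
by have := ltn_ord (s i); have := ltn_ord i; move: le_i le_si lt_mu => /=; lia.
Qed.

Lemma trans_diag a b (mu : intpart) : trans a b mu mu = 1.
Proof.
apply: det_unitri => [j i lt_ji|j]; rewrite mxE ?ser_lead //.
apply: ser_small; have := part_le mu (ltnW lt_ji).
by have := ltn_ord i; lia.
Qed.

End TransitionMatrix.

Lemma psize_contained (mu nu : intpart) : (forall j, part mu j <= part nu j)%N ->
  mu = nu \/ (psize mu < psize nu)%N.
Proof.
move=> sub_mn; set n := maxn (size mu) (size nu).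
have [mu_n nu_n] : (size mu <= n /\ size nu <= n)%N by rewrite leq_maxl leq_maxr.
have [[j lt_j]|all_eq] := pselect (exists j, part mu j < part nu j)%N; [right|left].
  have lt_jn : (j < n)%N by rewrite (leq_trans _ nu_n) // -part_pos (leq_ltn_trans _ lt_j).
  rewrite (psizeE mu_n) (psizeE nu_n) (bigD1 (Ordinal lt_jn)) //=.
  rewrite [X in (_ < X)%N](bigD1 (Ordinal lt_jn)) //= -addSn.
  by apply: leq_add => //; apply: leq_sum.
apply: intpartP => j; apply/eqP; rewrite eqn_leq sub_mn leqNgt.
by apply/negP => lt_j; apply: all_eq; exists j.
Qed.

(** * Inverting kernels that are unitriangular for the size of partitions *)

Section Unitriangular.
Variable R : comNzRingType.
Implicit Type K : intpart -> intpart -> R.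

Definition unitri K : Prop :=
  (forall mu, K mu mu = 1) /\
  (forall mu nu, K mu nu != 0 -> mu = nu \/ (psize mu < psize nu)%N).

Lemma trans_unitri (a b : R) : unitri (trans a b).
Proof.
split=> [mu|mu nu t_neq0]; first exact: trans_diag.
by apply: psize_contained => j; apply: trans_part t_neq0.
Qed.

Lemma unitri_le K mu nu : unitri K -> K mu nu != 0 -> (psize mu <= psize nu)%N.
Proof. by case=> _ K_lt /K_lt [->|/ltnW]. Qed.

(** The recursion solves X K = 1 for the column of [mu], given K mu mu = 1; [d] is fuel, sufficient
    once it exceeds the size of [mu]. *)
Fixpoint kinvd K d ka mu : R :=
  if d is d'.+1 then
    (ka == mu)%:R - \sum_(nu <- plist (psize mu) | (psize nu < psize mu)%N)
      kinvd K d' ka nu * K nu mu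
  else 0.

Definition kinv K ka mu : R := kinvd K (psize mu).+1 ka mu.

Lemma kinvd_stable K d d' ka mu : (psize mu < d)%N -> (psize mu < d')%N ->
  kinvd K d ka mu = kinvd K d' ka mu.
Proof.
elim: d d' mu => [//|d IHd] [//|d'] mu; rewrite !ltnS => lt_d lt_d' /=.
congr (_ - _); apply: eq_bigr => nu lt_nu; congr (_ * _).
by apply: IHd; apply: leq_trans lt_nu _.
Qed.

Lemma kinvE K ka mu :
  kinv K ka mu = (ka == mu)%:R -
    \sum_(nu <- plist (psize mu) | (psize nu < psize mu)%N) kinv K ka nu * K nu mu.
Proof.
rewrite {1}/kinv /=; congr (_ - _); apply: eq_bigr => nu lt_nu; congr (_ * _).
exact: kinvd_stable.
Qed.

Lemma kinv_unitri K : unitri (kinv K).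
Proof.
have supp ka mu : kinv K ka mu != 0 -> ka = mu \/ (psize ka < psize mu)%N.
  have [m le_m] := ubnP (psize mu); elim: m => // m IHm in mu le_m *.
  rewrite kinvE; have [->|ne_mu] := eqVneq ka mu; first by left.
  rewrite sub0r oppr_eq0 => sum_neq0; right; apply: contraR sum_neq0.
  rewrite -leqNgt => le_ka; apply/eqP/big1_seq => nu /andP [lt_nu _].
  have [->|nz] := eqVneq (kinv K ka nu) 0; first by rewrite mul0r.
  by case: (IHm nu (leq_trans lt_nu le_m) nz) => [eq_ka|]; rewrite ?eq_ka in le_ka *; lia.
split=> // mu; rewrite kinvE eqxx big1 ?subr0 // => nu lt_nu.
have [->|nz] := eqVneq (kinv K mu nu) 0; first by rewrite mul0r.
by case: (supp _ _ nz) => [eq_mu|]; [move: lt_nu; rewrite eq_mu ltnn | lia].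
Qed.

Lemma kinvK K ka mu d : unitri K -> (psize mu <= d)%N ->
  \sum_(nu <- plist d) kinv K ka nu * K nu mu = (ka == mu)%:R.
Proof.
move=> K_tri le_d.
transitivity (\sum_(nu <- plist (psize mu)) kinv K ka nu * K nu mu).
  apply: eq_sum_supp; rewrite ?plist_uniq // => nu nz; apply: mem_plist.
    by apply: leq_trans le_d; apply: unitri_le K_tri _; apply: contraNneq nz => ->; rewrite mulr0.
  by apply: unitri_le K_tri _; apply: contraNneq nz => ->; rewrite mulr0.
rewrite (bigD1_seq mu) ?plist_uniq ?mem_plist //= (K_tri.1 mu) mulr1 kinvE.
rewrite big_mkcond [X in _ + X]big_mkcond /= addrAC -addrA.
rewrite -sumrB big1 ?addr0 // => nu _.
have [->|ne_nu] := eqVneq nu mu; first by rewrite ltnn subr0.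
have [->|nz] := eqVneq (K nu mu) 0; first by rewrite mulr0 if_same subr0.
by case: (K_tri.2 _ _ nz) ne_nu => [->|lt_nu _]; rewrite ?eqxx // lt_nu subrr.
Qed.

(** X is unitriangular too and so has a left inverse Y; then Y = Y X K = K, and K X = Y X = 1.
    Triangularity keeps all sums inside [plist d]. *)
Lemma kinvKV K ka mu d : unitri K -> (psize mu <= d)%N ->
  \sum_(nu <- plist d) K ka nu * kinv K nu mu = (ka == mu)%:R.
Proof.
move=> K_tri le_d; set X := kinv K; have X_tri := kinv_unitri K.
suff KE pi nu : (psize nu <= d)%N -> K pi nu = kinv X pi nu.
  rewrite -(kinvK _ X_tri le_d); apply: eq_bigr => nu _; rewrite -/X.
  have [->|nz] := eqVneq (X nu mu) 0; first by rewrite !mulr0.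
  by rewrite KE // (leq_trans (unitri_le X_tri nz)).
move=> le_nu; transitivity (\sum_(ro <- plist d) (pi == ro)%:R * K ro nu).
  have [K0|nz] := eqVneq (K pi nu) 0; last first.
    rewrite (sum_delta (la := pi)) ?plist_uniq ?eqxx ?mul1r //.
      by apply: mem_plist; apply: leq_trans (unitri_le K_tri nz) le_nu.
    by move=> ro; rewrite eq_sym => /negPf ->; rewrite mul0r.
  rewrite big1 // => ro _; have [<-|_] := eqVneq pi ro; last by rewrite mul0r.
  by rewrite K0 mulr0.
transitivity (\sum_(ro <- plist d) (\sum_(si <- plist d) kinv X pi si * X si ro) * K ro nu).
  apply: eq_bigr => ro _; have [->|nz] := eqVneq (K ro nu) 0; first by rewrite !mulr0.
  by rewrite kinvK // (leq_trans (unitri_le K_tri nz)).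
under eq_bigr do rewrite mulr_suml.
rewrite exchange_big /=.
under eq_bigr do (under eq_bigr do rewrite -mulrA; rewrite -mulr_sumr kinvK //).
rewrite (sum_delta (la := nu)) ?plist_uniq ?mem_plist ?eqxx ?mulr1 //.
by move=> si /negPf ->; rewrite mulr0.
Qed.

End Unitriangular.

(** * Schur polynomials *)

Section Strips.
Variable R : comNzRingType.
Implicit Types (y : R) (nu ka : intpart).

Definition strip y nu ka : R := strip_wt (maxn (size nu) (size ka)) y nu ka.

Lemma strip_wtE n y nu ka : (size nu <= n)%N -> (size ka <= n)%N ->
  strip_wt n y nu ka = strip y nu ka.
Proof.
move=> le_nu le_ka; have le_n : (maxn (size nu) (size ka) <= n)%N by rewrite geq_max le_nu.
rewrite -(subnK le_n); elim: (n - _)%N => // k IHk.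
rewrite addSn /strip_wt big_ord_recr /= -/(strip_wt _ _ _ _) IHk.
rewrite /strw !part_default ?mulr1 //;
  by rewrite ?leqW // (leq_trans _ (leq_addl _ _)) ?leq_maxl ?leq_maxr.
Qed.

Definition hstrip nu ka : bool :=
  [forall i : 'I_(maxn (size nu) (size ka)), (part nu i.+1 <= part ka i <= part nu i)%N].

Lemma hstripP nu ka :
  reflect (forall i, (part nu i.+1 <= part ka i <= part nu i)%N) (hstrip nu ka).
Proof.
apply: (iffP forallP) => // strip_nk i.
have [lt_i|] := ltnP i (maxn (size nu) (size ka)); first exact: (strip_nk (Ordinal lt_i)).
by rewrite geq_max => /andP [le_nu le_ka]; rewrite !part_default // leqW.
Qed.

Lemma hstrip_refl nu : hstrip nu nu.
Proof. by apply/hstripP => i; rewrite leqnn part_leS. Qed.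

Lemma stripE y nu ka : strip y nu ka = (hstrip nu ka)%:R * y ^+ (psize nu - psize ka).
Proof.
rewrite /strip /strip_wt; set n := maxn _ _.
have [ok|] := boolP (hstrip nu ka); last first.
  rewrite negb_forall mul0r => /existsP [i bad].
  by rewrite (bigD1 i) //= {1}/strw (negPf bad) mul0r.
rewrite mul1r (psizeE (leq_maxl (size nu) (size ka) : (_ <= n)%N)).
rewrite (psizeE (leq_maxr (size nu) (size ka) : (_ <= n)%N)).
rewrite -sumnB => [|i _]; last by have /andP [] := hstripP _ _ ok i.
by rewrite expr_sum; apply: eq_bigr => i _; rewrite /strw (hstripP _ _ ok).
Qed.

Lemma strip_neq0 y nu ka : strip y nu ka != 0 -> hstrip nu ka.
Proof. by rewrite stripE; case: hstrip; rewrite ?mul0r ?eqxx. Qed.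

Lemma hstrip_le nu ka : hstrip nu ka -> (psize ka <= psize nu)%N.
Proof.
move/hstripP => ok; case: (@psize_contained ka nu) => [i|-> //|/ltnW //].
by case/andP: (ok i).
Qed.

Lemma hstrip_lt nu ka : hstrip nu ka -> ka != nu -> (psize ka < psize nu)%N.
Proof.
move/hstripP => ok; case: (@psize_contained ka nu) => [i|->|//].
  by case/andP: (ok i).
by rewrite eqxx.
Qed.

Lemma hstrip_size nu ka : hstrip nu ka -> (size nu <= (size ka).+1)%N.
Proof.
move/hstripP => ok; rewrite size_le_part -leqn0.
have /andP [le_k _] := ok (size ka).
by apply: leq_trans le_k _; rewrite part_default.
Qed.

(** The row operation of [dv_interval] for powers of a variable: the interval sum appears with the
    factor z - y, which will become a factor of the Vandermonde product. *)
Lemma geom_interval y z s (a b : nat) : (a <= b)%N ->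
  z ^+ (b + s.+1) - y ^+ (b.+1 - a) * z ^+ (a + s) =
  (z - y) * \sum_(a <= k < b.+1) y ^+ (b - k) * z ^+ (k + s).
Proof.
move/subnK <-; elim: (b - a)%N => [|d IHd].
  by rewrite add0n subSnn big_nat1 subnn expr0 mul1r addnS exprS expr1; ring.
rewrite big_nat_recr /=; last lia.
rewrite subnn expr0 mul1r mulrDr.
rewrite big_nat_cond (eq_bigr (fun k => y * (y ^+ (d + a - k) * z ^+ (k + s)))).
  rewrite -big_nat_cond -mulr_sumr mulrCA -IHd.
  have -> : ((d.+1 + a).+1 - a = ((d + a).+1 - a).+1)%N by lia.
  by rewrite addSn !addnS !addSn !exprS; ring.
by move=> k /andP [/andP [_ le_k] _]; rewrite mulrA -exprS -subSn.
Qed.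

Lemma det_scale_cols n (u : 'I_n -> R) (E : 'I_n -> 'I_n -> R) :
  \det (\matrix_(j < n, i < n) (u i * E j i)) =
  (\prod_i u i) * \det (\matrix_(j < n, i < n) E j i).
Proof.
rewrite /determinant mulr_sumr; apply: eq_bigr => s _.
rewrite mulrCA [X in _ = _ * (X * _)](reindex_inj (@perm_inj _ s)) -big_split /=; congr (_ * _).
by apply: eq_bigr => i _; rewrite !mxE.
Qed.

End Strips.

Section SchurPoly.
Variable R : comNzRingType.
Implicit Types nu ka : intpart.
Local Notation widen := (widen_ord (leqnSn _)).

(** The branching rule is taken as definition because it involves no division; the bialternant
    formula is then derived from it. *)
Fixpoint spoly n nu : {mpoly R[n]} :=
  if n is n'.+1 then
    \sum_(ka <- plist (psize nu)) mwiden (spoly n' ka) * strip 'X_ord_max nu ka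
  else (nu == part0)%:R.

(** A horizontal strip removes at most one row, and there are only [n] strips. *)
Lemma spoly_big n nu : (n < size nu)%N -> spoly n nu = 0.
Proof.
elim: n nu => [|n IHn] nu lt_nu /=.
  by case: eqP lt_nu => // ->.
apply: big1 => ka _.
have [->|/strip_neq0 ok] := eqVneq (strip ('X_ord_max : {mpoly R[n.+1]}) nu ka) 0.
  by rewrite mulr0.
by rewrite IHn ?mwiden0 ?mul0r // -ltnS (leq_trans lt_nu) ?hstrip_size.
Qed.

Definition vdm n : {mpoly R[n]} := \prod_(i < n) \prod_(j < n | (i < j)%N) ('X_i - 'X_j).

Lemma mwidenXi n (i : 'I_n) : mwiden ('X_i : {mpoly R[n]}) = 'X_(widen i).
Proof. by rewrite mwidenX mnmwiden1. Qed.

Lemma vdmS n : vdm n.+1 = mwiden (vdm n) * \prod_(i < n) ('X_(widen i) - 'X_ord_max).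
Proof.
rewrite /vdm big_ord_recr /= [X in _ * X]big_pred0 ?mulr1; last first.
  by move=> j; rewrite ltnNge -ltnS ltn_ord.
rewrite rmorph_prod -big_split; apply: eq_bigr => i _ /=.
rewrite big_mkcond big_ord_recr /= ltn_ord rmorph_prod; congr (_ * _).
rewrite [RHS]big_mkcond /=; apply: eq_bigr => j _.
by rewrite mwidenB !mwidenXi.
Qed.

Definition alternant n nu : {mpoly R[n]} :=
  \det (\matrix_(i < n, j < n) 'X_i ^+ (part nu j + (n - j.+1))).

(** After transposition, the row operation with the last variable [x] clears the column of [x]
    except in the last row; the other columns acquire the factors x_i - x and the strip sums. *)
Lemma alternantS n nu : (size nu <= n.+1)%N ->
  alternant n.+1 nu = (\prod_(i < n) ('X_(widen i) - 'X_ord_max)) *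
    \sum_(ka <- pbox n (part nu 0)) mwiden (alternant n ka) * strip 'X_ord_max nu ka.
Proof.
move=> le_nu; set x : {mpoly R[n.+1]} := 'X_ord_max.
rewrite /alternant -det_tr.
pose A (i : 'I_n.+1) j := ('X_i : {mpoly R[n.+1]}) ^+ (part nu j + (n.+1 - j.+1)).
transitivity (\det (\matrix_(j < n.+1, i < n.+1) A i j)).
  by congr (\det _); apply/matrixP => i j; rewrite !mxE.
rewrite -(det_add_next _ (fun j => - x ^+ ((part nu j).+1 - part nu j.+1))).
rewrite (expand_det_col _ ord_max) (bigD1 ord_max) //= big1 => [|j ne_j]; last first.
  have lt_j : (j < n)%N by have := ltn_ord j; have : (j != n :> nat) := ne_j; lia.
  rewrite mxE ltnS lt_j /A -/x mulNr -exprD.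
  have := part_leS nu j => le_j.
  rewrite (_ : _ + _ = part nu j + (n.+1 - j.+1))%N ?subrr ?mul0r //; lia.
rewrite mxE ltnn addr0 /A -/x subnn addn0 addr0.
rewrite /cofactor -signr_odd oddD addbb expr0 mul1r.
pose E (j i : 'I_n) := \sum_(k < (part nu 0).+1)
  strw x (part nu j.+1) (part nu j) k * ('X_(widen i) : {mpoly R[n.+1]}) ^+ (k + (n - j.+1)).
have -> : row' ord_max (col' ord_max (\matrix_(j < n.+1, i < n.+1)
   ('X_i ^+ (part nu j + (n.+1 - j.+1)) +
     (if (j.+1 < n.+1)%N then - x ^+ ((part nu j).+1 - part nu j.+1) *
        'X_i ^+ (part nu j.+1 + (n.+1 - j.+2)) else 0)))) =
   \matrix_(j < n, i < n) (('X_(widen i) - x) * E j i).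
  apply/matrixP => j i; rewrite !mxE (_ : lift ord_max i = widen i); last first.
    by apply: val_inj; apply: lift_max.
  rewrite lift_max ltnS ltn_ord mulNr /E.
  rewrite (sum_strw _ _ (fun k => 'X_(widen i) ^+ (k + (n - j.+1)))) ?part_le //.
  have -> : (n.+1 - j.+1 = (n - j.+1).+1)%N by have := ltn_ord j; lia.
  by rewrite geom_interval ?part_leS.
rewrite det_scale_cols mulrCA; congr (_ * _).
have := det_sum_rows (fun j k => strw x (part nu j.+1) (part nu j) (k : 'I_(part nu 0).+1))
  (fun j k i => ('X_(widen i) : {mpoly R[n.+1]}) ^+ (k + (n - j.+1))).
rewrite /E => ->; pose D (f : nat -> nat) :=
  \det (\matrix_(j < n, i < n) ('X_(widen i) : {mpoly R[n.+1]}) ^+ (f j + (n - j.+1))).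
rewrite (eq_bigr (fun f : {ffun 'I_n -> 'I_(part nu 0).+1} =>
   (\prod_(i < n) strw x (part nu i.+1) (part nu i) (f i)) * D (natfun f))); last first.
  move=> f _; congr (_ * \det _); apply/matrixP => j i.
by rewrite !mxE natfunE.
rewrite sum_strip_pbox => [|f g eq_fg]; last first.
  by congr (\det _); apply/matrixP => j i; rewrite !mxE eq_fg.
rewrite mulr_sumr; apply: eq_big_seq => ka; rewrite mem_pbox => /andP [le_ka _].
(* The entry x^(nu_n) of the last row is the factor of the strip weight at index n, where [ka] has
   no part. *)
rewrite -(@strip_wtE _ n.+1) ?(leq_trans le_ka) // /strip_wt big_ord_recr /=.
rewrite -/(strip_wt n x nu ka) /strw (part_default le_nu) (part_default le_ka) subn0 /=.
rewrite mulrA mulrC; congr (_ * _); last by rewrite mulrC.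
rewrite -det_map_mx /D -det_tr; congr (\det _); apply/matrixP => i j; rewrite !mxE.
by rewrite rmorphXn /= mwidenXi.
Qed.

Lemma spoly_vdm n nu : (size nu <= n)%N -> spoly n nu * vdm n = alternant n nu.
Proof.
elim: n nu => [|n IHn] nu le_nu.
  rewrite /= /vdm big_ord0 mulr1 /alternant det_mx00.
  by case: eqP => // ne0; case: ne0; apply/eqP; rewrite -val_eqE /= -size_eq0 -leqn0.
rewrite alternantS // vdmS mulrA [RHS]mulrC; congr (_ * _) => /=.
rewrite (@eq_sum_supp _ _ (pbox n (part nu 0))) ?plist_uniq ?pbox_uniq //; first last.
- move=> ka nz; rewrite mem_pbox; apply/andP; split.
    rewrite leqNgt; apply: contraNN nz => /spoly_big ->.
    by rewrite mwiden0 mul0r.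
  have /strip_neq0 /hstripP ok : strip ('X_ord_max : {mpoly R[n.+1]}) nu ka != 0.
    by apply: contraNneq nz => ->; rewrite mulr0.
  by case/andP: (ok 0%N).
- move=> ka nz; apply: mem_plist; apply: hstrip_le.
  apply: (@strip_neq0 _ ('X_ord_max : {mpoly R[n.+1]})).
  by apply: contraNneq nz => ->; rewrite mulr0.
rewrite mulr_suml; apply: eq_big_seq => ka; rewrite mem_pbox => /andP [le_ka _].
by rewrite mulrAC -mwidenM IHn.
Qed.

End SchurPoly.

(** * Multivariate power series *)

Section Series.
Variables (n : nat) (R : comNzRingType).
Implicit Types (f g : mpseries n R) (p q : {mpoly R[n]}).

Lemma mpsD p q : mps (p + q) = mps p + mps q.
Proof. by apply: mpsP => m /=; rewrite mcoeffD. Qed.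

Lemma mpsB p q : mps (p - q) = mps p - mps q.
Proof. by apply: mpsP => m /=; rewrite mcoeffB. Qed.

Lemma mpsM p q : mps (p * q) = mps p * mps q.
Proof.
apply: mpsP => m; rewrite [RHS](mps_mulE _ _ (ltnSn (mdeg m))) /=.
by apply: eq_mcoeffM => k le_k; rewrite mcoeff_trunc.
Qed.

Lemma mps_is_zmod_morphism : zmod_morphism (@mps n R).
Proof. exact: mpsB. Qed.

Lemma mps_is_monoid_morphism : monoid_morphism (@mps n R).
Proof. by split=> //; apply: mpsM. Qed.

HB.instance Definition _ := GRing.isZmodMorphism.Build _ _ (@mps n R) mps_is_zmod_morphism.
HB.instance Definition _ := GRing.isMonoidMorphism.Build _ _ (@mps n R) mps_is_monoid_morphism.

Lemma mps_inj : injective (@mps n R).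
Proof.
by move=> p q eq_pq; apply/mpolyP => m; rewrite -[p@_m]/(mps p m) eq_pq.
Qed.

Lemma mps_addE f g m : (f + g) m = f m + g m. Proof. by []. Qed.

Lemma mps_oppE f m : (- f) m = - f m. Proof. by []. Qed.

Lemma mps_sumE (I : Type) (r : seq I) (P : pred I) (F : I -> mpseries n R) m :
  (\sum_(i <- r | P i) F i) m = \sum_(i <- r | P i) F i m.
Proof.
apply: (big_morph (fun f : mpseries n R => f m)) => [f g|]; first exact: mps_addE.
by rewrite -[LHS]/((0 : {mpoly R[n]})@_m) mcoeff0.
Qed.

Lemma mcoeffMXi p (i : 'I_n) m :
  (p * 'X_i)@_m = if (0 < m i)%N then p@_(m - U_(i))%MM else 0.
Proof.
case: ifP => [m_i|m_i].
  have le_m : (U_(i) <= m)%MM by apply/mnm_lepP => j; rewrite mnm1E; case: eqP => [<-|].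
  by rewrite -{1}(submK le_m) addmC mcoeffMX.
apply: memN_msupp_eq0; rewrite (perm_mem (msuppMX _ _)); apply/mapP => -[k _ m_eq].
by move: m_i; rewrite m_eq mnmDE mnm1E eqxx.
Qed.

Lemma mps_mulX f (i : 'I_n) m :
  (f * mps 'X_i) m = if (0 < m i)%N then f (m - U_(i))%MM else 0.
Proof.
rewrite [LHS](mps_mulE _ _ (ltnSn (mdeg m))).
rewrite (@eq_mcoeffM _ _ _ (mps_trunc (mdeg m).+1 f) _ 'X_i) //; last first.
  by move=> k le_k; rewrite mcoeff_trunc.
rewrite mcoeffMXi; case: ifP => // _; rewrite mcoeff_trunc //.
by rewrite ltnS mdegB.
Qed.

(** The coefficient at m + U_i shows that f_m is unchanged when one unit of exponent moves from
    variable j to variable i; once variable j is exhausted the coefficient is 0. *)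
Lemma mulXB_eq0 f (i j : 'I_n) : i != j -> f * (mps 'X_i - mps 'X_j) = 0 -> f = 0.
Proof.
move=> ne_ij f0; apply: mpsP => m.
rewrite -[RHS]/((0 : {mpoly R[n]})@_m) mcoeff0.
have [k le_k] := ubnP (m j); elim: k => // k IHk in m le_k *.
have := congr1 (fun g : mpseries n R => g (m + U_(i))%MM) f0.
rewrite -[RHS]/((0 : {mpoly R[n]})@_(m + U_(i))%MM) mcoeff0 mulrBr.
rewrite mps_addE mps_oppE !mps_mulX !mnmDE !mnm1E eqxx addn1 /= addmK (negPf ne_ij) addn0.
case: posnP => [_|m_j]; first by rewrite subr0.
rewrite [f (_ - _)%MM]IHk ?subr0 // mnmBE mnmDE !mnm1E eqxx (negPf ne_ij); lia.
Qed.

Lemma vandermonde_regular f : f * vandermonde R n = 0 -> f = 0.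
Proof.
rewrite /vandermonde; move: f.
elim/big_ind: _ => [f|v w IHv IHw f|i _ f]; first by rewrite mulr1.
  by rewrite mulrA => /IHw /IHv.
move: f; elim/big_ind: _ => [f|v w IHv IHw f|j lt_ij f]; first by rewrite mulr1.
  by rewrite mulrA => /IHw /IHv.
by apply: mulXB_eq0; apply: contraTneq lt_ij => ->; rewrite ltnn.
Qed.

Lemma vandermonde_mps : vandermonde R n = mps (vdm R n).
Proof.
rewrite /vandermonde /vdm rmorph_prod; apply: eq_bigr => i _.
by rewrite rmorph_prod; apply: eq_bigr => j _; rewrite rmorphB.
Qed.

Lemma vandermonde_inj f g :
  f * vandermonde R n = g * vandermonde R n -> f = g.
Proof.
move=> eq_fg; apply/eqP; rewrite -subr_eq0; apply/eqP/vandermonde_regular.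
by rewrite mulrBl eq_fg subrr.
Qed.

Lemma vdm_inj p q : p * vdm R n = q * vdm R n -> p = q.
Proof.
move=> eq_pq; apply: mps_inj; apply: vandermonde_inj.
by rewrite vandermonde_mps -!rmorphM /= eq_pq.
Qed.

End Series.

(** * Symmetry, homogeneity and stability of Schur polynomials *)

Section SchurPolyProps.
Variable R : comNzRingType.
Implicit Types nu ka : intpart.

Lemma spoly0 n : spoly R n part0 = 1.
Proof.
elim: n => [|n IHn] /=; first by [].
rewrite (sum_delta (la := part0)) ?plist_uniq ?mem_plist //.
  by rewrite IHn mwiden1 mul1r stripE hstrip_refl subnn mul1r.
move=> ka ne_ka; rewrite stripE; case: (boolP (hstrip _ _)) => [ok|_]; last first.
  by rewrite mul0r mulr0.
by have := hstrip_lt ok ne_ka; rewrite ltn0.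
Qed.

Lemma vdm_alternant n : vdm R n = alternant R n part0.
Proof. by rewrite -spoly_vdm // spoly0 mul1r. Qed.

Lemma msym_alternant n (s : 'S_n) nu :
  msym s (alternant R n nu) = (-1) ^+ s * alternant R n nu.
Proof.
rewrite /alternant -det_map_mx -det_perm -det_mulmx -row_permE.
congr (\det _); apply/matrixP => i j; rewrite !mxE rmorphXn /=; congr (_ ^+ _).
rewrite msymX; congr 'X_[_]; apply/mnmP => k; rewrite mnmE !mnm1E.
by rewrite -(inj_eq (@perm_inj _ s)) permKV.
Qed.

(** The alternant and the Vandermonde product change by the same sign, and the latter is regular. *)
Lemma spoly_sym n nu : spoly R n nu \is symmetric.
Proof.
have [le_nu|lt_nu] := leqP (size nu) n; last by rewrite spoly_big ?rpred0.
apply/issymP => s; apply: vdm_inj.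
have := msym_alternant s nu; rewrite -spoly_vdm // msymM vdm_alternant msym_alternant.
rewrite -vdm_alternant; set e := (-1) ^+ s => eq_s.
have ee : e * e = 1 by rewrite -signr_addb addbb.
rewrite -[LHS]mul1r -[RHS]mul1r -ee -!mulrA -eq_s.
by congr (_ * _); rewrite mulrCA.
Qed.

Lemma mdeg_mnmwiden n (m : 'X_{1..n}) : mdeg (mnmwiden m) = mdeg m.
Proof.
rewrite !mdegE big_ord_recr /= mnmwiden_ordmax addn0.
by apply: eq_bigr => i _; rewrite mnmwiden_widen.
Qed.

Lemma mwiden_homog n d (p : {mpoly R[n]}) : p \is d.-homog -> mwiden p \is d.-homog.
Proof.
move=> p_d; rewrite (mwidenE (leqnn (msize p))); apply: rpred_sum => m _.
have [->|nz] := eqVneq p@_m 0; first by rewrite scale0r rpred0.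
apply: rpredZ; rewrite dhomogX /= mdeg_mnmwiden.
by apply: contraNT nz => ne_d; rewrite (dhomog_nemf_coeff p_d ne_d).
Qed.

Lemma spoly_homog n nu : spoly R n nu \is (psize nu).-homog.
Proof.
elim: n nu => [|n IHn] nu /=.
  by case: eqP => [->|_]; [apply: dhomog1 | apply: rpred0].
apply: rpred_sum => ka _; rewrite stripE; case: (boolP (hstrip _ _)) => [ok|_]; last first.
  by rewrite mul0r mulr0 rpred0.
rewrite mul1r; set d := (psize nu - psize ka)%N.
have <- : (psize ka + 1 * d = psize nu)%N by rewrite mul1n subnKC ?hstrip_le.
apply: dhomogM; first exact: mwiden_homog.
by apply: dhomogMn; rewrite dhomogX /= mdeg1.
Qed.

Lemma spoly_deg n nu m : (spoly R n nu)@_m != 0 -> psize nu = mdeg m.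
Proof.
by apply: contra_neq_eq => ne; apply: dhomog_nemf_coeff (spoly_homog _ _) _; rewrite eq_sym.
Qed.

(** A nonempty strip contributes a positive power of the last variable, so only ka = nu survives. *)
Lemma spoly_stable n nu m : (spoly R n.+1 nu)@_(mnmwiden m) = (spoly R n nu)@_m.
Proof.
rewrite /= raddf_sum /= (sum_delta (la := nu)) ?plist_uniq ?mem_plist //.
  by rewrite stripE hstrip_refl subnn expr0 !mulr1 mwiden_mnmwiden.
move=> ka ne_ka; rewrite stripE; case: (boolP (hstrip _ _)) => [ok|_]; last first.
  by rewrite mul0r mulr0 mcoeff0.
have := hstrip_lt ok ne_ka; rewrite -subn_gt0 mul1r; case: (_ - _)%N => // k _.
by rewrite exprSr mulrA mcoeffMXi mnmwiden_ordmax.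
Qed.

End SchurPolyProps.

(** * Coefficients of bialternants *)

Section Separated.
Variables (n : nat) (R : comNzRingType).
Implicit Types (F G : mpseries n R) (c : 'I_n -> nat -> R) (i : 'I_n).

(* F is a product of power series, one in each variable. *)
Definition sep F c : Prop := forall m, F m = \prod_i c i (m i).

Definition upd c i (f : nat -> R) : 'I_n -> nat -> R :=
  fun j => if j == i then f else c j.

Lemma eq_sep F c c' : (forall j, c j =1 c' j) -> sep F c -> sep F c'.
Proof. by move=> eq_c F_c m; rewrite F_c; apply: eq_bigr => j _; rewrite eq_c. Qed.

Lemma sep_eq F G c : sep F c -> sep G c -> F = G.
Proof. by move=> F_c G_c; apply: mpsP => m; rewrite F_c G_c. Qed.

Lemma prod_upd c i f (m : 'X_{1..n}) :
  \prod_j upd c i f j (m j) = f (m i) * \prod_(j | j != i) c j (m j).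
Proof.
rewrite (bigD1 i) //= /upd eqxx; congr (_ * _).
by apply: eq_bigr => j /negPf ->.
Qed.

Lemma upd_upd c i f g j : upd (upd c i f) i g j =1 upd c i g j.
Proof. by move=> e; rewrite /upd; case: eqP. Qed.

Lemma sep1 : sep 1 (fun=> @d0 R).
Proof.
move=> m; rewrite -[LHS]/((1 : {mpoly R[n]})@_m) mcoeff1.
have [->|ne_m] := eqVneq m 0%MM; first by rewrite big1 // => i _; rewrite mnm0E.
have [i m_i] : exists i, m i != 0%N.
  apply/existsP; apply: contraNT ne_m; rewrite negb_exists => /forallP m0.
  by apply/eqP/mnmP => i; rewrite mnm0E; apply/eqP; rewrite -[_ == _]negbK.
by rewrite (bigD1 i) //= /d0 (negPf m_i) mul0r.
Qed.

Lemma sep_mulX F c i : sep F c -> sep (F * mps 'X_i) (upd c i (sh (c i))).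
Proof.
move=> F_c m; rewrite mps_mulX prod_upd.
case: posnP => [->|m_i]; first by rewrite mul0r.
rewrite F_c (bigD1 i) //= mnmBE mnm1E eqxx subn1.
case: (m i) m_i => // k _ /=; congr (_ * _).
by apply: eq_bigr => j ne_j; rewrite mnmBE mnm1E eq_sym (negPf ne_j) subn0.
Qed.

Lemma mps_mul_const F (b : R) m : (F * mps b%:MP) m = b * F m.
Proof.
rewrite mulrC [LHS](mps_mulE _ _ (ltnSn (mdeg m))).
rewrite (@eq_mcoeffM _ _ _ b%:MP _ (mps_trunc (mdeg m).+1 F)) //.
  by rewrite mcoeffCM mcoeff_trunc.
by move=> k le_k; rewrite mcoeff_trunc.
Qed.

Lemma sep_mb F c i b : sep F c -> sep (F * mps (1 + b *: 'X_i)) (upd c i (mb b (c i))).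
Proof.
move=> F_c m; rewrite mpsD mulrDr mulr1 mps_addE -mul_mpolyC mpsM mulrCA mulrC mps_mul_const.
rewrite (sep_mulX i F_c) !prod_upd F_c (bigD1 i) //= /mb mulrDl mulrA.
by [].
Qed.

Definition sepser c : mpseries n R := MPSeries (fun m => \prod_i c i (m i)).

Lemma sepser_dv c i (a : R) :
  sep (sepser (upd c i (dv a (c i))) * mps (1 - a *: 'X_i)) c.
Proof.
rewrite -scaleNr.
have := @sep_mb (sepser (upd c i (dv a (c i)))) (upd c i (dv a (c i))) i (- a) (fun=> erefl).
apply: eq_sep => j e; rewrite upd_upd /upd; case: eqP => // ->.
by rewrite eqxx /mb dvE mulNr addrK.
Qed.

(** The inverse is the geometric series in variable [i], written as a separated series. *)
Lemma unit_1BaX i (a : R) : mps (1 - a *: 'X_i) \is a @GRing.unit (mpseries n R).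
Proof.
set u := mps _; have := sep_eq (sepser_dv (fun=> @d0 R) i a) sep1.
by move=> inv_u; apply/unitrP; eexists; split; [exact: inv_u | rewrite mulrC; exact: inv_u].
Qed.

Lemma sep_dv F c i a : sep F c -> sep (F / mps (1 - a *: 'X_i)) (upd c i (dv a (c i))).
Proof.
move=> F_c; rewrite -(sep_eq (sepser_dv c i a) F_c) mulrK ?unit_1BaX //.
Qed.

Lemma sep_exp (u : mpseries n R) i (op : (nat -> R) -> nat -> R) k F c :
    (forall f g, f =1 g -> op f =1 op g) ->
    (forall F c, sep F c -> sep (F * u) (upd c i (op (c i)))) ->
  sep F c -> sep (F * u ^+ k) (upd c i (iter k op (c i))).
Proof.
move=> eq_op step F_c; elim: k => [|k IHk].
  by rewrite expr0 mulr1; apply: eq_sep F_c => j e; rewrite /upd; case: eqP => // ->.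
rewrite exprSr mulrA; apply: eq_sep (step _ _ IHk) => j e.
by rewrite upd_upd /upd eqxx.
Qed.

(** The hypothesis on [c i] expresses that variable [i] has not occurred in [F] yet. *)
Lemma sep_ser F c i (a b : R) j k : c i =1 @d0 R -> sep F c ->
  sep (F * (mps 'X_i ^+ (k + (n - j.+1)) * mps (1 + b *: 'X_i) ^+ j
            / mps (1 - a *: 'X_i) ^+ k)) (upd c i (ser a b n j k)).
Proof.
move=> c_i F_c; rewrite -exprVn [_ * _ ^+ k]mulrC mulrA.
rewrite [_ ^+ (k + _) * _]mulrC mulrA.
have s1 := @sep_exp _ i (dv a) k F c (@eq_dv R a) (fun F c => @sep_dv F c i a) F_c.
have s2 := @sep_exp _ i (mb b) j _ _ (@eq_mb R b) (fun F c => @sep_mb F c i b) s1.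
have s3 := @sep_exp _ i (@sh R) (k + (n - j.+1)) _ _ (@eq_sh R) (fun F c => @sep_mulX F c i) s2.
apply: eq_sep s3 => l e; rewrite upd_upd /upd; case: eqP => // _; rewrite !eqxx.
apply: eq_iter_op; first exact: eq_sh.
apply: eq_iter_op; first exact: eq_mb.
by apply: eq_iter_op c_i; apply: eq_dv.
Qed.

Lemma sep_X F c i k : c i =1 @d0 R -> sep F c ->
  sep (F * mps 'X_i ^+ k) (upd c i (fun e => (e == k)%:R)).
Proof.
move=> c_i F_c.
have := @sep_exp _ i (@sh R) k F c (@eq_sh R) (fun F c => @sep_mulX F c i) F_c.
apply: eq_sep => j e; rewrite /upd; case: eqP => // _; rewrite iter_sh.
case: leqP => [le_k|lt_e]; last by case: eqP lt_e => // ->; rewrite ltnn.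
by rewrite c_i /d0 subn_eq0 eqn_leq le_k andbT.
Qed.

Lemma sep_prod (u : 'I_n -> mpseries n R) (cs : 'I_n -> nat -> R) :
    (forall i F c, c i =1 @d0 R -> sep F c -> sep (F * u i) (upd c i (cs i))) ->
  sep (\prod_i u i) cs.
Proof.
move=> step.
suff prod_r (r : seq 'I_n) : uniq r ->
    sep (\prod_(i <- r) u i) (fun j => if j \in r then cs j else @d0 R).
  have := prod_r (enum 'I_n) (enum_uniq _); rewrite big_enum /=.
  by apply: eq_sep => j e; rewrite mem_enum.
elim: r => [_|i r IHr /andP [i_r r_uniq]]; first by rewrite big_nil; apply: sep1.
rewrite big_cons mulrC; have := step i _ _ _ (IHr r_uniq).
rewrite (negPf i_r) => /(_ (frefl _)); apply: eq_sep => j e.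
by rewrite /upd inE; case: eqP => [->|].
Qed.

(** Each Leibniz term is a product of series in distinct variables, so its coefficients are products
    of coefficients. *)
Lemma coef_det (u : 'I_n -> 'I_n -> mpseries n R) (cs : 'I_n -> nat -> R) m :
    (forall i j F c, c i =1 @d0 R -> sep F c -> sep (F * u i j) (upd c i (cs j))) ->
  (\det (\matrix_(i, j) u i j)) m = \det (\matrix_(i < n, j < n) cs j (m i)).
Proof.
move=> step; rewrite /determinant mps_sumE; apply: eq_bigr => s _.
have := @sep_prod (fun i => u i (s i)) (fun i => cs (s i)) (fun i => step i (s i)).
have -> : \prod_i (\matrix_(i, j) u i j) i (s i) = \prod_i u i (s i).
  by apply: eq_bigr => i _; rewrite mxE.
have -> : \prod_i (\matrix_(i < n, j < n) cs j (m i)) i (s i) = \prod_i cs (s i) (m i).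
  by apply: eq_bigr => i _; rewrite mxE.
by move=> prod_s; rewrite !mulr_sign; case: (s : bool); rewrite ?mps_oppE prod_s.
Qed.

End Separated.

(** * Alternating functions of exponents *)

Section Alternating.
Variables (n : nat) (R : comNzRingType).

Definition alternating (A : 'X_{1..n} -> R) : Prop :=
  (forall (m : 'X_{1..n}) i j, i != j -> m i = m j -> A m = 0) /\
  (forall (m : 'X_{1..n}) (s : 'S_n), A [multinom m (s i) | i < n] = (-1) ^+ s * A m).

Definition mdet (p : 'I_n -> nat -> R) (m : 'X_{1..n}) : R :=
  \det (\matrix_(i < n, j < n) p j (m i)).

Lemma mdet_alternating p : alternating (mdet p).
Proof.
split=> [m i j ne_ij eq_m|m s].
  by apply: (determinant_alternate ne_ij) => k; rewrite !mxE eq_m.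
rewrite /mdet -det_perm -det_mulmx -row_permE; congr (\det _).
by apply/matrixP => i j; rewrite !mxE mnmE.
Qed.

Lemma sum_alternating (I : Type) (r : seq I) (P : pred I) (c : I -> R) A :
  (forall i, alternating (A i)) -> alternating (fun m => \sum_(i <- r | P i) c i * A i m).
Proof.
move=> alt; split=> [m i j ne_ij eq_m|m s].
  by rewrite big1 // => k _; rewrite ((alt k).1 m i j) ?mulr0.
by rewrite mulr_sumr; apply: eq_bigr => k _; rewrite (alt k).2 mulrCA.
Qed.

Definition deltam (ka : intpart) : 'X_{1..n} :=
  [multinom (part ka i + (n - i.+1))%N | i < n].

(** Strict decrease gives m_i >= n - 1 - i, so delta can be subtracted. *)
Lemma sorted_deltam (m : 'X_{1..n}) : (forall i j : 'I_n, (i < j)%N -> (m j < m i)%N) ->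
  exists2 ka : intpart, (size ka <= n)%N & m = deltam ka.
Proof.
move=> dec; pose g j := if insub j is Some o then (m o : nat) else 0%N.
have gE (i : 'I_n) : g i = m i by rewrite /g valK.
have g_ge d j : (j + d < n)%N -> (d <= g j)%N.
  elim: d j => // d IHd j lt_n; have lt_j : (j.+1 < n)%N by lia.
  have := IHd j.+1; rewrite addSnnS => /(_ lt_n) le_d.
  have := dec (Ordinal (ltnW lt_j)) (Ordinal lt_j) (leqnn _).
  by rewrite -!gE /=; apply: leq_trans.
pose f j := (g j - (n - j.+1))%N.
have f_dec : nonincr n f.
  move=> i lt_i; have := dec (Ordinal (ltnW lt_i)) (Ordinal lt_i) (leqnn _).
  by rewrite -!gE /= /f; lia.
exists (mkpart n f).
  by rewrite size_le_part part_mkpart // ltnn.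
apply/mnmP => i; rewrite mnmE part_mkpart // ltn_ord /f gE subnK //.
by rewrite -gE; apply: g_ge; have := ltn_ord i; lia.
Qed.

(** An exponent with a repeated entry gives 0 on both sides; any other can be sorted to some ka +
    delta. Sorting keeps the degree, so that sums truncated by degree can be compared. *)
Lemma alternating_ext A B m : alternating A -> alternating B ->
    (forall ka : intpart, (size ka <= n)%N -> mdeg (deltam ka) = mdeg m ->
       A (deltam ka) = B (deltam ka)) ->
  A m = B m.
Proof.
move=> [A0 As] [B0 Bs] eq_AB.
have [inj_m|] := boolP [forall i, forall j, (i != j) ==> (m i != m j)]; last first.
  rewrite negb_forall => /existsP [i]; rewrite negb_forall => /existsP [j].
  rewrite negb_imply negbK => /andP [ne_ij /eqP eq_m].
  by rewrite (A0 _ i j) // (B0 _ i j).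
have [s sE] : exists s : 'S_n, sort geq m = [tuple m (s i) | i < n] :> seq nat.
  have /tuple_permP [s sE] : perm_eq (sort_tuple geq m) m by rewrite perm_sort.
  by exists s; rewrite /= in sE *; rewrite sE.
pose m' := [multinom m (s i) | i < n].
have [ka le_ka m'E] : exists2 ka : intpart, (size ka <= n)%N & m' = deltam ka.
  apply: sorted_deltam => i j lt_ij; rewrite !mnmE ltn_neqAle; apply/andP; split.
    have ne_s : s j != s i by rewrite (inj_eq perm_inj) -val_eqE /=; lia.
    by have /forallP /(_ (s j)) /forallP /(_ (s i)) := inj_m; rewrite ne_s.
  have srt : sorted geq [tuple m (s i) | i < n].
    by rewrite -sE; apply: sort_sorted => x y; apply: leq_total.
  have trans_geq : transitive geq by move=> x y z le1 le2; apply: leq_trans le2 le1.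
  have := sorted_ltn_nth trans_geq 0%N srt i j.
  rewrite !inE size_tuple !ltn_ord => /(_ isT isT lt_ij).
  by rewrite -!tnth_nth !tnth_mktuple.
have eq_m' : A m' = B m'.
  by rewrite m'E; apply: eq_AB => //; rewrite -m'E mdeg_mperm.
have := congr1 ( *%R ((-1) ^+ s)) eq_m'.
by rewrite As Bs !mulrA -signr_addb addbb !mul1r.
Qed.

(** If the exponents match along a permutation s, [perm_reaches] for s gives ka_j <= nu_j, and for
    its inverse nu_j <= ka_j. *)
Lemma mdet_delta (nu ka : intpart) : (size nu <= n)%N -> (size ka <= n)%N ->
  mdet (fun j e => (e == part nu j + (n - j.+1))%N%:R) (deltam ka) = (ka == nu)%:R.
Proof.
move=> le_nu le_ka; have [<-|ne_ka] := eqVneq ka nu.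
  rewrite /mdet (_ : (\matrix_(i, j) _) = 1%:M) ?det1 //.
  apply/matrixP => i j; rewrite !mxE mnmE; congr (nat_of_bool _)%:R.
  apply/eqP/eqP => [|-> //] eq_ij; apply: val_inj => /=.
  have := ltn_ord i; have := ltn_ord j.
  by case: (ltngtP i j) => // lt_ij; have := part_le ka (ltnW lt_ij); lia.
apply/eqP; apply: contraNT ne_ka => /det_neq0 [s].
move=> s_eq; have {}s_eq (i : 'I_n) : (part ka i + (n - i.+1) = part nu (s i) + (n - (s i).+1))%N.
  by have := s_eq i; rewrite mxE mnmE; case: (eqVneq (part ka i + _)%N) => // _; rewrite eqxx.
apply/eqP/intpartP => j; have [le_j|lt_j] := leqP n j.
  by rewrite !part_default // (leq_trans _ le_j).
have [i le_i le_si] := perm_reaches s (Ordinal lt_j).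
have [k le_k le_sk] := perm_reaches s^-1%g (Ordinal lt_j).
have := s_eq i; have := s_eq (s^-1%g k); rewrite permKV.
have := part_le ka le_i; have := part_le ka le_sk.
have := part_le nu le_si; have := part_le nu le_k.
have := ltn_ord i; have := ltn_ord k; have := ltn_ord (s i); have := ltn_ord (s^-1%g k).
by move: le_i le_si le_k le_sk => /=; lia.
Qed.

End Alternating.

(** * Schur expansions *)

Lemma symseries_ext (R : comNzRingType) (F G : symseries R) :
  (forall n, F n = G n) -> F = G.
Proof.
case: F G => [F Fs Ft] [G Gs Gt] /= eq_FG.
have eq_fun : F = G by apply: functional_extensionality_dep.
by case: _ / eq_fun in Gs Gt *; congr SymSeries; apply: Prop_irrelevance.
Qed.

Lemma symfun_ext (R : comNzRingType) (f g : symfun R) :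
  (forall n, f n = g n) -> f = g.
Proof.
case: f g => [f fs ft fb] [g gs gt gb] /= eq_fg.
have eq_fun : f = g by apply: functional_extensionality_dep.
by case: _ / eq_fun in gs gt gb *; congr SymFun; apply: Prop_irrelevance.
Qed.

Section Expansions.
Variable R : comNzRingType.
Implicit Types (c : intpart -> R) (a b : R).

(** The possibly infinite sum of c_nu s_nu: by homogeneity only partitions of size [mdeg m] reach
    the monomial [m]. *)
Definition expser c n : mpseries n R :=
  MPSeries (fun m => \sum_(nu <- plist (mdeg m)) c nu * (spoly R n nu)@_m).

Lemma expser_list c n (m : 'X_{1..n}) d : (mdeg m <= d)%N ->
  expser c n m = \sum_(nu <- plist d) c nu * (spoly R n nu)@_m.
Proof.
move=> le_d; apply: eq_sum_supp; rewrite ?plist_uniq // => nu nz; apply: mem_plist;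
  by rewrite (@spoly_deg R n nu m) //; apply: contraNneq nz => ->; rewrite mulr0.
Qed.

Fact expser_sym c n (s : 'S_n) (m : 'X_{1..n}) :
  expser c n [multinom m (s i) | i < n] = expser c n m.
Proof.
rewrite /= mdeg_mperm; apply: eq_bigr => nu _; congr (_ * _).
exact/msym_coeff/spoly_sym.
Qed.

Fact expser_stable c n (m : 'X_{1..n}) : expser c n.+1 (mnmwiden m) = expser c n m.
Proof.
by rewrite /= mdeg_mnmwiden; apply: eq_bigr => nu _; rewrite -spoly_stable.
Qed.

Definition expsym c : symseries R := SymSeries (@expser_sym c) (@expser_stable c).

Lemma coef_alternant n nu m :
  (alternant R n nu)@_m = mdet (fun j e => (e == part nu j + (n - j.+1))%N%:R) m.
Proof.
rewrite -[LHS]/(mps (alternant R n nu) m) /alternant -det_map_mx.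
rewrite (_ : map_mx _ _ = \matrix_(i, j) mps 'X_i ^+ (part nu j + (n - j.+1))); last first.
  by apply/matrixP => i j; rewrite !mxE rmorphXn.
by apply: coef_det => i j F c; apply: sep_X.
Qed.

Lemma expser_vdm c n (m : 'X_{1..n}) :
  (expser c n * vandermonde R n) m =
  \sum_(nu <- plist (mdeg m) | (size nu <= n)%N)
     c nu * mdet (fun j e => (e == part nu j + (n - j.+1))%N%:R) m.
Proof.
(* The coefficient of the product at [m] sees only degrees up to that of [m], where the series
   agrees with the polynomial [P]. *)
pose P := \sum_(nu <- plist (mdeg m)) c nu *: spoly R n nu.
transitivity ((mps P * vandermonde R n) m).
  apply: eq_bigr => k _; congr (_ * _).
  rewrite (@expser_list c n _ (mdeg m)); last by rewrite -ltnS bmdeg.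
  by rewrite /P /= raddf_sum; apply: eq_bigr => nu _ /=; rewrite mcoeffZ.
rewrite vandermonde_mps -mpsM /= /P mulr_suml raddf_sum /= [RHS]big_mkcond /=.
apply: eq_bigr => nu _; rewrite -scalerAl mcoeffZ.
case: leqP => [le_nu|lt_nu]; last by rewrite spoly_big // mul0r mcoeff0 mulr0.
by rewrite spoly_vdm // coef_alternant.
Qed.

Lemma psize_deltam n (ka : intpart) : (size ka <= n)%N -> (psize ka <= mdeg (deltam n ka))%N.
Proof.
move=> le_ka; rewrite mdegE (psizeE le_ka); apply: leq_sum => i _.
by rewrite mnmE leq_addr.
Qed.

(** Coefficients are read off at ka + delta; Schur expansions are therefore unique. *)
Lemma expser_vdm_deltam c n (ka : intpart) : (size ka <= n)%N ->
  (expser c n * vandermonde R n) (deltam n ka) = c ka.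
Proof.
move=> le_ka; rewrite expser_vdm big_mkcond /= (sum_delta (la := ka)) ?plist_uniq //.
- by rewrite le_ka mdet_delta // eqxx mulr1.
- by apply: mem_plist; apply: psize_deltam.
move=> nu ne_nu; case: leqP => // le_nu.
by rewrite mdet_delta // eq_sym (negPf ne_nu) mulr0.
Qed.

Lemma expser_inj c c' : (forall n, expser c n = expser c' n) -> c = c'.
Proof.
move=> eq_c; apply: funext => ka.
by rewrite -(expser_vdm_deltam c (leqnn (size ka))) eq_c expser_vdm_deltam.
Qed.

Lemma bialternant_eq l (M : forall n, 'M[mpseries n R]_n) (F : symseries R) :
    (forall n, (l <= n)%N -> F n * vandermonde R n = \det (M n)) ->
  bialternant l M = F.
Proof.
move=> F_det; apply: xget_unique => // G G_det; apply: symseries_ext => n.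
(* For n >= l the Vandermonde product determines the restriction; fewer variables follow by
   stability, by induction on how far n lies below l. *)
have [k le_k] : exists k, (l <= n + k)%N by exists l; rewrite leq_addl.
elim: k n le_k => [|k IHk] n; rewrite ?addn0 => le_n.
  by apply: vandermonde_inj; rewrite F_det // G_det.
by apply: mpsP => m; rewrite -(symseries_stable G) -(symseries_stable F) IHk // addSnnS.
Qed.

Lemma expser_delta la n : expser (fun nu => (nu == la)%:R) n = mps (spoly R n la).
Proof.
apply: mpsP => m; rewrite (@expser_list _ _ _ (maxn (mdeg m) (psize la))) ?leq_maxl //.
rewrite (sum_delta (la := la)) ?plist_uniq ?eqxx ?mul1r ?mem_plist ?leq_maxr //.
by move=> mu /negPf ->; rewrite mul0r.
Qed.

Lemma schurE la n m : schur R la n m = (spoly R n la)@_m.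
Proof.
rewrite /schur (@bialternant_eq _ _ (expsym (fun nu => (nu == la)%:R))).
  by rewrite -[LHS]/(expser _ _ _) expser_delta.
move=> {m}n le_n; have -> : expsym (fun nu => (nu == la)%:R) n = mps (spoly R n la).
  exact: expser_delta.
rewrite vandermonde_mps -mpsM spoly_vdm //.
rewrite /alternant -det_map_mx; congr (\det _); apply/matrixP => i j.
by rewrite !mxE rmorphXn.
Qed.

Lemma schur_expansionP (F : symseries R) c :
  schur_expansion F c <-> (forall n, F n = expser c n).
Proof.
have sumE n (m : 'X_{1..n}) :
    \sum_(la \in [set: intpart]%classic) c la * schur R la n m = expser c n m.
  rewrite (fsum_seq (plist_uniq (mdeg m))).
    by apply: eq_bigr => nu _; rewrite schurE.
  move=> nu; rewrite schurE => nz; apply: mem_plist.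
  by rewrite (@spoly_deg R n nu m) //; apply: contraNneq nz => ->; rewrite mulr0.
split=> [exp n|eqF n m]; last by rewrite sumE eqF.
by apply: mpsP => m; rewrite exp sumE.
Qed.

Lemma schur_coefE (F : symseries R) c : (forall n, F n = expser c n) -> schur_coef F = c.
Proof.
move=> FE; apply: xget_unique; first exact/schur_expansionP.
move=> c' /schur_expansionP FE'; apply: expser_inj => n.
by rewrite -FE -FE'.
Qed.

(** After multiplication by the Vandermonde product both sides are alternating in the exponents, and
    at ka + delta both are [transn]. *)
Lemma grothendieckE a b mu : grothendieck a b mu = expsym (trans a b mu).
Proof.
apply: bialternant_eq => n le_n; apply: mpsP => m; rewrite [LHS]expser_vdm.
rewrite (@coef_det n R _ (fun j => ser a b n j (part mu j))); last first.
  by move=> i j F c; apply: sep_ser.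
rewrite -/(mdet (fun j => ser a b n j (part mu j)) m).
apply: (@alternating_ext _ _ (fun m' => \sum_(nu <- plist (mdeg m) | (size nu <= n)%N)
     trans a b mu nu * mdet (fun j e => (e == part nu j + (n - j.+1))%N%:R) m')).
- by apply: sum_alternating => nu; apply: mdet_alternating.
- exact: mdet_alternating.
move=> ka le_ka deg_ka; rewrite big_mkcond /= (sum_delta (la := ka)) ?plist_uniq //.
- rewrite le_ka mdet_delta // eqxx mulr1 -(@transnE _ _ _ n) // /transn /mdet -det_tr.
  by congr (\det _); apply/matrixP => i j; rewrite !mxE mnmE.
- by apply: mem_plist; rewrite -deg_ka psize_deltam.
move=> nu ne_nu; case: leqP => // le_nu.
by rewrite mdet_delta // eq_sym (negPf ne_nu) mulr0.
Qed.

End Expansions.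

(** * The dual polynomials *)

Section Dual.
Variables (R : comNzRingType) (al be : R).
Let K := trans (- al) (- be).
Let X := kinv K.
Let K_tri : unitri K := trans_unitri _ _.
Let X_tri : unitri X := kinv_unitri _.

Definition dualpoly (la : intpart) n : {mpoly R[n]} :=
  \sum_(nu <- plist (psize la)) kinv (trans (- al) (- be)) nu la *: spoly R n nu.

Fact dualpoly_sym la n : dualpoly la n \is symmetric.
Proof. by apply: rpred_sum => nu _; apply/rpredZ/spoly_sym. Qed.

Fact dualpoly_stable la n (m : 'X_{1..n}) :
  (dualpoly la n.+1)@_(mnmwiden m) = (dualpoly la n)@_m.
Proof.
rewrite !raddf_sum; apply: eq_bigr => nu _ /=.
by rewrite !mcoeffZ -spoly_stable.
Qed.

Fact dualpoly_bounded la : exists d, forall n, (msize (dualpoly la n) <= d)%N.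
Proof.
exists (psize la).+1 => n; rewrite msizeE; apply/bigmax_leqP_seq => m m_supp _.
rewrite ltnS leqNgt; apply: contraTN m_supp => lt_m; rewrite mcoeff_msupp negbK.
rewrite raddf_sum big1 //= => nu _; rewrite mcoeffZ -/(X nu la).
have [->|nz] := eqVneq (X nu la) 0; first by rewrite mul0r.
have [->|nz_m] := eqVneq (spoly R n nu)@_m 0; first by rewrite mulr0.
by move: lt_m; rewrite -(spoly_deg nz_m) ltnNge (unitri_le X_tri nz).
Qed.

Definition dualfun la : symfun R :=
  SymFun (dualpoly_sym la) (@dualpoly_stable la) (dualpoly_bounded la).

Lemma dualpoly_expser la n : mps (dualpoly la n) = expser (X^~ la) n.
Proof.
apply: mpsP => m; rewrite -[LHS]/((dualpoly la n)@_m) /dualpoly raddf_sum /=.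
under eq_bigr do rewrite mcoeffZ.
apply: eq_sum_supp; rewrite ?plist_uniq // => nu nz; apply: mem_plist.
  by apply: unitri_le X_tri _; apply: contraNneq nz => X0; rewrite -/(X nu la) X0 mul0r.
by rewrite (@spoly_deg R n nu m) //; apply: contraNneq nz => ->; rewrite mulr0.
Qed.

Lemma hall_grothendieck (f : symfun R) c mu d :
    (forall n, mps (f n) = expser c n) -> (forall nu, c nu != 0 -> (psize nu <= d)%N) ->
  hall f (grothendieck (- al) (- be) mu) = \sum_(nu <- plist d) c nu * K mu nu.
Proof.
move=> fE c_d; rewrite /hall (@schur_coefE _ (symseries_of f) c) //.
rewrite grothendieckE (@schur_coefE _ _ (K mu)) //.
rewrite (fsum_seq (plist_uniq d)) // => nu nz; apply/mem_plist/c_d.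
by apply: contraNneq nz => ->; rewrite mul0r.
Qed.

Lemma hall_dualfun la mu : hall (dualfun la) (grothendieck (- al) (- be) mu) = (la == mu)%:R.
Proof.
rewrite (@hall_grothendieck _ (X^~ la) mu (psize la)); first last.
- by move=> nu; apply: unitri_le.
- by move=> n; apply: dualpoly_expser.
by under eq_bigr do rewrite mulrC; rewrite kinvKV // eq_sym.
Qed.

(** By homogeneity the part of the expansion beyond the degree bound of [f] sums to zero in every
    degree, so uniqueness makes it vanish. *)
Lemma symfun_expansion_bounded (f : symfun R) c : (forall n, mps (f n) = expser c n) ->
  exists d, forall nu, c nu != 0 -> (psize nu <= d)%N.
Proof.
move=> fE; have [d f_d] := symfun_bounded f; exists d => nu; apply: contraR.
rewrite -ltnNge => lt_d; pose c' nu := if (d < psize nu)%N then c nu else 0.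
suff c'0 : c' = fun=> 0 by have := congr1 (@^~ nu) c'0; rewrite /c' lt_d => ->.
apply: expser_inj => n; apply: mpsP => m; rewrite /= [RHS]big1 => [|ka _]; last by rewrite mul0r.
have [le_m|lt_m] := leqP (mdeg m) d.
  apply: big1 => ka _; rewrite /c'; case: ltnP => [lt_ka|]; last by rewrite mul0r.
  have [->|nz] := eqVneq (spoly R n ka)@_m 0; first by rewrite mulr0.
  by move: lt_ka; rewrite (spoly_deg nz) ltnNge le_m.
have := congr1 (fun F : mpseries n R => F m) (fE n) => /=.
rewrite memN_msupp_eq0 => [sum0|]; last by apply/msize_mdeg_ge/(leq_trans (f_d n))/ltnW.
rewrite [RHS]sum0; apply: eq_bigr => ka _; rewrite /c'; case: ltnP => // le_ka.
have [->|nz] := eqVneq (spoly R n ka)@_m 0; first by rewrite !mulr0.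
by move: le_ka; rewrite (spoly_deg nz) leqNgt lt_m.
Qed.

(* A symmetric function without Schur expansion has all its Hall products
   equal to 0, so the defining equations of the dual force an expansion. *)
Lemma dual_grothendieckE la : dual_grothendieck al be la = dualfun la.
Proof.
apply: xget_unique => [mu|f f_dual]; first exact: hall_dualfun.
have [c fE] : exists c, forall n, mps (f n) = expser c n.
  have [[c]|no_c] := pselect (exists c, schur_expansion (symseries_of f) c).
    by move/schur_expansionP => fE; exists c.
  have := f_dual la; rewrite eqxx /hall [schur_coef (symseries_of f)]xgetPN; last first.
    by move=> c exp_c; apply: no_c; exists c.
  rewrite fsbig1 => [/eqP|mu _]; last by rewrite mul0r.
  by rewrite eq_sym oner_eq0.
have [d c_d] := symfun_expansion_bounded fE.
pose e := maxn d (psize la).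
have c_e nu : c nu != 0 -> (psize nu <= e)%N by move/c_d => le_d; rewrite leq_max le_d.
(* The Hall equations say that K c is the unit vector at [la]; applying the left inverse X recovers
   c. *)
have cE ka : c ka = X ka la.
  transitivity (\sum_(mu <- plist e) X ka mu * \sum_(nu <- plist e) c nu * K mu nu).
    under eq_bigr do rewrite mulr_sumr.
    rewrite exchange_big /=.
    transitivity (\sum_(nu <- plist e) c nu * (ka == nu)%:R).
      have [c0|nz] := eqVneq (c ka) 0.
        rewrite c0 big1 // => nu _; case: eqP => [<-|_]; last by rewrite mulr0.
        by rewrite c0 mul0r.
      rewrite (sum_delta (la := ka)) ?plist_uniq ?mem_plist ?c_e ?eqxx ?mulr1 //.
      by move=> nu; rewrite eq_sym => /negPf ->; rewrite mulr0.
    apply: eq_bigr => nu _; under eq_bigr do rewrite mulrCA.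
    rewrite -mulr_sumr; have [->|/c_e le_e] := eqVneq (c nu) 0; first by rewrite !mul0r.
    by rewrite kinvK.
  transitivity (\sum_(mu <- plist e) X ka mu * (la == mu)%:R).
    by apply: eq_bigr => mu _; rewrite -f_dual (hall_grothendieck mu fE c_e).
  rewrite (sum_delta (la := la)) ?plist_uniq ?mem_plist ?leq_maxr ?eqxx ?mulr1 //.
  by move=> mu; rewrite eq_sym => /negPf ->; rewrite mulr0.
apply: symfun_ext => n; apply: mps_inj; rewrite [RHS]dualpoly_expser fE.
by congr (expser _ n); apply: funext.
Qed.

End Dual.

(** * Statistics of skew shapes, row by row *)

Lemma part_subP (mu la : intpart) :
  reflect (forall j, part mu j <= part la j)%N (part_sub mu la).
Proof.
apply: (iffP forallP) => // sub_ml j.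
have [le_j|lt_j] := leqP (size mu) j; first by rewrite part_default.
exact: (sub_ml (Ordinal lt_j)).
Qed.

Lemma count_interval (h a b : nat) : (b <= h)%N ->
  (\sum_(j < h) (a <= j < b))%N = (b - a)%N.
Proof.
move=> le_b; rewrite -[RHS]muln1 -sum_nat_const_nat (@big_nat_widenl _ _ _ a 0) //.
rewrite (@big_nat_widen _ _ _ 0 b h) // big_mkord [RHS]big_mkcond /=.
by apply: eq_bigr => j _; case: (_ && _).
Qed.

Lemma sum_unique_bool n (P : pred 'I_n) : (forall i j, P i -> P j -> i = j) ->
  (\sum_(i < n) P i)%N = [exists i, P i].
Proof.
move=> P_uniq; case: existsP => [[i Pi]|none].
  rewrite (bigD1 i) //= Pi big1 // => j ne_j.
  by apply/eqP; rewrite eqb0; apply: contraNN ne_j => Pj; apply/eqP/P_uniq.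
by apply: big1 => i _; apply/eqP; rewrite eqb0; apply/negP => Pi; apply: none; exists i.
Qed.

Section Shape.
Variables (la mu : intpart).
Hypothesis sub_ml : forall j, (part mu j <= part la j)%N.
Local Notation L := (part la).
Local Notation m := (part mu).
Let p := prevpart mu (part la 0).

Let le_mp j : (m j <= p j)%N.
Proof. by case: j => [|j]; [apply: sub_ml | apply: part_leS]. Qed.

Let le_head j : (L j <= head 0%N la)%N.
Proof. by rewrite -nth0; apply: part_le. Qed.

Lemma mem_cells z : (z \in skew_cells la mu) = (m z.1 <= z.2 < L z.1)%N.
Proof. by []. Qed.

Lemma skew_sizeE : skew_size la mu = (\sum_(i < size la) (L i - m i))%N.
Proof.
rewrite /skew_size -sum1_card big_mkcond /=.
rewrite -(pair_bigA _ (fun i j => if (i, j) \in skew_cells la mu then 1%N else 0%N)) /=.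
by apply: eq_bigr => i _; rewrite -(@count_interval (head 0%N la) (m i) (L i)).
Qed.

Lemma skew_rowsE : skew_rows la mu = (\sum_(i < size la) (m i < L i))%N.
Proof.
rewrite /skew_rows -sum1_card big_mkcond /=; apply: eq_bigr => i _; rewrite inE.
rewrite (_ : [exists j, _] = (m i < L i)%N); first by case: (_ < _)%N.
apply/existsP/idP => [[j]|lt_mL].
  by rewrite mem_cells => /andP [/leq_ltn_trans]; apply.
exists (Ordinal (leq_trans lt_mL (le_head i))).
by rewrite mem_cells /= leqnn.
Qed.

(* The factor [j < p i] selects the top cell of column j. *)
Lemma skew_colsE : skew_cols la mu = (\sum_(i < size la) (minn (L i) (p i) - m i))%N.
Proof.
transitivity (\sum_(j < head 0%N la) \sum_(i < size la) (m i <= j < minn (L i) (p i)))%N.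
  rewrite /skew_cols -sum1_card big_mkcond /=; apply: eq_bigr => j _; rewrite inE.
  rewrite sum_unique_bool => [|i i']; last first.
    rewrite !leq_min => /and3P [le_i _ lt_i] /and3P [le_i' _ lt_i'].
    have below a a' : (m a <= j)%N -> (j < p a')%N -> (a < a')%N -> False.
      case: a' => // a' le_a lt_a'; rewrite ltnS => /(part_le mu) le_aa.
      by move: (leq_trans lt_a' le_aa); rewrite ltnNge le_a.
    apply: val_inj => /=; case: (ltngtP i i') => // lt_ii.
      by case: (below _ _ le_i lt_i' lt_ii).
    by case: (below _ _ le_i' lt_i lt_ii).
  suff -> : [exists i, (i, j) \in skew_cells la mu] =
      [exists i : 'I_(size la), (m i <= j < minn (L i) (p i))%N].
    by case: [exists i, _].
  apply/existsP/existsP => [[i i_cell]|[i]]; last first.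
    by rewrite leq_min => /and3P [le_i lt_i _]; exists i; rewrite mem_cells /= le_i.
  pose P := [pred i : 'I_(size la) | (i, j) \in skew_cells la mu].
  have [k] := @arg_minnP _ i P (fun i => i : nat) i_cell.
  rewrite /P /= mem_cells /= => k_cell k_min; exists k; rewrite leq_min.
  case/andP: (k_cell) => -> -> /=.
  case: k k_cell k_min => -[|k] lt_k /= k_cell k_min; first by rewrite -[L 0]nth0.
  rewrite ltnNge; apply/negP => le_j.
  have := k_min (Ordinal (ltnW lt_k)); rewrite mem_cells /= le_j ltnn.
  by rewrite (leq_trans _ (part_leS la k)) ?(andP k_cell).2 // => /(_ isT).
rewrite exchange_big /=; apply: eq_bigr => i _; apply: count_interval.
by rewrite geq_min le_head.
Qed.

(** * Connected components of a skew shape *)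

Local Notation adj := (skew_adj la mu).

Lemma skew_adjE z w : adj z w =
  [&& z \in skew_cells la mu, w \in skew_cells la mu &
      (z.1 == w.1) && consecutive z.2 w.2 || (z.2 == w.2) && consecutive z.1 w.1].
Proof. by []. Qed.

Lemma skew_adj_sym : ssrbool.symmetric adj.
Proof.
move=> z w; rewrite !skew_adjE /consecutive andbCA [z.1 == _]eq_sym [z.2 == _]eq_sym.
by rewrite [(z.2.+1 == _) || _]orbC [(z.1.+1 == _) || _]orbC.
Qed.

Let connectC : connect_sym adj := sym_connect_sym skew_adj_sym.

Lemma connect_row (i : 'I_(size la)) (j k : 'I_(head 0%N la)) : (j <= k)%N ->
  (i, j) \in skew_cells la mu -> (i, k) \in skew_cells la mu ->
  connect adj (i, j) (i, k).
Proof.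
case: k => k lt_k /= le_jk; have := subnK le_jk; move: (k - j)%N => d.
elim: d k lt_k {le_jk} => [|d IHd] k lt_k.
  by rewrite add0n => eq_jk _ _; rewrite (_ : j = Ordinal lt_k) //; apply: val_inj.
case: k lt_k => [|k] lt_k; first by rewrite addSn.
rewrite addSn => -[eq_jk] j_cell k_cell.
have k'_cell : (i, Ordinal (ltnW lt_k)) \in skew_cells la mu.
  by move: j_cell k_cell; rewrite !mem_cells /= -eq_jk; lia.
apply: connect_trans (IHd _ (ltnW lt_k) eq_jk j_cell k'_cell) (connect1 _).
by rewrite skew_adjE k'_cell k_cell eqxx /= /consecutive eqxx.
Qed.

(* The top row of the component of a nonempty row i of la/mu. *)
Fixpoint toprow (i : nat) : nat :=
  if i is i'.+1 then if (L i <= m i')%N then i else toprow i' else 0%N.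

Lemma toprow_le i : (toprow i <= i)%N.
Proof. by elim: i => //= i IHi; case: ifP => // _; apply: leqW. Qed.

Lemma toprow_start i : (m i < L i)%N ->
  (m (toprow i) < L (toprow i) <= p (toprow i))%N.
Proof.
elim: i => [|i IHi] lt_i; first by rewrite lt_i leqnn.
rewrite /=; case: ifP => [le_i|/negbT]; first by rewrite lt_i.
by rewrite -ltnNge => /leq_trans lt; apply/IHi/lt/part_leS.
Qed.

Lemma toprow_id i : (L i <= p i)%N -> toprow i = i.
Proof. by case: i => //= i ->. Qed.

Lemma adj_toprow z w : adj z w -> toprow z.1 = toprow w.1.
Proof.
case: z w => [[i lt_i] j] [[i' lt_i'] j']; rewrite skew_adjE /= => /and3P [].
rewrite !mem_cells /= => /andP [le_j lt_j] /andP [le_j' lt_j'].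
case/orP => /andP [/eqP eq1]; first by move: eq1 => [->].
rewrite -{}eq1 in le_j' lt_j'; rewrite /consecutive => /orP [] /eqP eq_i.
  by rewrite -eq_i /= ifF //; apply/negbTE; rewrite -ltnNge (leq_ltn_trans le_j) // eq_i.
by rewrite -eq_i /= ifF //; apply/negbTE; rewrite -ltnNge (leq_ltn_trans le_j') // eq_i.
Qed.

Lemma connect_toprow z w : connect adj z w -> toprow z.1 = toprow w.1.
Proof.
case/connectP => s + ->; elim: s z => //= x s IHs z /andP [zx /IHs <-].
exact: adj_toprow.
Qed.

Definition firstcell (i : 'I_(size la)) (lt_i : (m i < L i)%N) : box la :=
  (i, Ordinal (leq_trans lt_i (le_head i))).

Lemma firstcell_mem i lt_i : @firstcell i lt_i \in skew_cells la mu.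
Proof. by rewrite mem_cells /= leqnn. Qed.

(** If row i + 1 meets row i, then m i < L (i + 1). A walk along row i + 1 to column m i and one
    step up lead to the first cell of row i. *)
Lemma connect_firstcell (i k : nat) (lt_i : (i < size la)%N) (lt_k : (k < size la)%N)
    (ne_i : (m i < L i)%N) (ne_k : (m k < L k)%N) : k = toprow i ->
  connect adj (@firstcell (Ordinal lt_i) ne_i) (@firstcell (Ordinal lt_k) ne_k).
Proof.
elim: i lt_i ne_i => [|i IHi] lt_i ne_i.
  by move=> /= k0; subst k; rewrite (bool_irrelevance lt_i lt_k) (bool_irrelevance ne_i ne_k).
rewrite /=; case: ifP => [_ eq_k|/negbT].
  by subst k; rewrite (bool_irrelevance lt_i lt_k) (bool_irrelevance ne_i ne_k).
rewrite -ltnNge => lt_L eq_k.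
have ne_i' : (m i < L i)%N by apply: leq_trans lt_L (part_leS _ _).
apply: connect_trans (IHi (ltnW lt_i) ne_i' eq_k).
pose c := Ordinal (leq_trans ne_i' (le_head i)).
have c_cell : (Ordinal lt_i, c) \in skew_cells la mu.
  by rewrite mem_cells /= part_leS.
apply: (@connect_trans _ _ (Ordinal lt_i, c)).
  by apply: connect_row c_cell; [apply: part_leS | apply: (@firstcell_mem (Ordinal lt_i))].
apply: connect1; rewrite skew_adjE c_cell firstcell_mem /= /consecutive !eqxx.
by rewrite !orbT.
Qed.

Lemma cell_connect_firstcell z : z \in skew_cells la mu ->
  exists ne_z, connect adj z (@firstcell z.1 ne_z).
Proof.
case: z => i j ij_cell; have := ij_cell; rewrite mem_cells /= => /andP [le_j lt_j].
exists (leq_ltn_trans le_j lt_j); rewrite connectC.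
by apply: connect_row; rewrite ?firstcell_mem.
Qed.

Lemma connect_cells z w : z \in skew_cells la mu -> w \in skew_cells la mu ->
  connect adj z w = (toprow z.1 == toprow w.1).
Proof.
move=> z_cell w_cell; apply/idP/eqP => [|eq_top]; first exact: connect_toprow.
have [ne_z z_first] := cell_connect_firstcell z_cell.
have [ne_w w_first] := cell_connect_firstcell w_cell.
case: z w z_cell w_cell eq_top ne_z z_first ne_w w_first => [[i lt_i] j] [[k lt_k] l] _ _.
move=> /= eq_top ne_z z_first ne_w w_first.
have lt_t := leq_ltn_trans (toprow_le i) lt_i.
have ne_t : (m (toprow i) < L (toprow i))%N by case/andP: (toprow_start ne_z).
apply: connect_trans z_first _; rewrite connectC.
apply: connect_trans w_first _.
apply: (connect_trans (connect_firstcell lt_k lt_t ne_w ne_t eq_top)).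
by rewrite connectC; apply: connect_firstcell.
Qed.

(** A component is counted by its top row: [toprow] is constant on components and separates them,
    and its values on cells are the nonempty rows that do not meet the row above. *)
Lemma skew_compsE : skew_comps la mu = (\sum_(i < size la) (m i < L i <= p i))%N.
Proof.
pose f (z : box la) := Ordinal (leq_ltn_trans (toprow_le z.1) (ltn_ord z.1)).
pose A := [set z : box la | roots adj z && (z \in skew_cells la mu)].
have cells_closed : closed adj (skew_cells la mu).
  by move=> z w; rewrite skew_adjE => /and3P [-> ->].
have f_inj : {in A &, injective f}.
  move=> z w; rewrite !inE => /andP [/eqP z_root z_cell] /andP [/eqP w_root w_cell] [eq_top].
  have : connect adj z w by rewrite connect_cells // eq_top.
  by move/(fingraph.rootP connectC); rewrite z_root w_root.
transitivity #|f @: A|.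
  by rewrite card_in_imset // cardsE.
have -> : f @: A = [set i : 'I_(size la) | (m i < L i <= p i)%N].
  apply/setP => i; rewrite inE; apply/imsetP/idP => [[z]|/andP [ne_i le_i]].
    rewrite inE => /andP [_]; rewrite mem_cells => /andP [le_z lt_z] ->.
    exact/toprow_start/(leq_ltn_trans le_z lt_z).
  exists (fingraph.root adj (firstcell ne_i)).
    rewrite inE roots_root //= -(closed_connect cells_closed (connect_root _ _)).
    exact: firstcell_mem.
  apply: val_inj => /=.
  by rewrite -(connect_toprow (connect_root _ (firstcell ne_i))) /= toprow_id.
rewrite -sum1_card big_mkcond /=; apply: eq_bigr => i _; rewrite inE.
by case: (_ && _).
Qed.

(** A nonempty row with L i <= p i starts a component; one with p i < L i shares L i - p i columns
    with the row above. Each statistic is first written as a sum over rows plus the term to be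
    subtracted, so that the natural subtractions in the exponents cancel exactly. *)
Lemma skew_gE_sub (R : comNzRingType) (a b x : R) :
  skew_g a b la mu x = skew_wt (size la) a b x la mu.
Proof.
rewrite /skew_g (introT (part_subP mu la) sub_ml) /skew_inner.
have rowsE : skew_rows la mu = (\sum_(i < size la) (p i < L i) + skew_comps la mu)%N.
  rewrite skew_rowsE skew_compsE -big_split; apply: eq_bigr => i _ /=.
  by have := le_mp i; case: (ltngtP (m i) (L i)) (ltnP (p i) (L i)) => ? [] /=; lia.
have colsE : skew_cols la mu =
    (\sum_(i < size la) (minn (L i) (p i) - m i - (m i < L i <= p i)) + skew_comps la mu)%N.
  rewrite skew_colsE skew_compsE -big_split; apply: eq_bigr => i _ /=.
  rewrite subnK //; case: (boolP (_ && _)) => //= /andP [lt_i le_i].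
  by rewrite (minn_idPl le_i) subn_gt0.
have sizeE : (skew_size la mu + skew_comps la mu = \sum_(i < size la) (L i - p i).-1 +
    (skew_cols la mu + skew_rows la mu))%N.
  rewrite skew_sizeE skew_compsE skew_colsE skew_rowsE -!big_split.
  apply: eq_bigr => i _ /=; have := le_mp i; have := sub_ml i.
  by rewrite /minn; case: (ltngtP (m i) (L i)) (ltnP (p i) (L i)) (ltnP (L i) (p i))
    => ? [] ? [] /=; lia.
rewrite sizeE addnK rowsE addnK colsE addnK skew_compsE !expr_sum -!big_split.
apply: eq_bigr => i _ /=; rewrite /roww; have := le_mp i; have := sub_ml i; rewrite -/p.
move: (m i) (L i) (p i) => mi Li pi le_mL le_mp'.
rewrite (ltnNge Li mi) le_mL /=; have [->|ne_L] := eqVneq Li mi.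
  by rewrite ltnn /= (minn_idPl le_mp') subnn sub0n (ltnNge pi) le_mp' /=
    !expr0 (eqP le_mp') !mulr1.
have lt_mL : (mi < Li)%N by rewrite ltn_neqAle eq_sym ne_L.
rewrite lt_mL /=; case: (leqP Li pi) => [le_Lp|lt_pL] /=.
  rewrite (eqP le_Lp) !expr0 !mul1r expr1 subn1; congr (_ * _).
by rewrite expr0 expr1 mulr1 subn0.
Qed.

End Shape.

(** Rows beyond those of [la] have weight 1; if [mu] is not contained in [la], a row with la_j <
    mu_j has weight 0. *)
Lemma skew_gE (R : comNzRingType) (a b x : R) n (la mu : intpart) :
    (size la <= n)%N -> (size mu <= n)%N ->
  skew_g a b la mu x = skew_wt n a b x la mu.
Proof.
move=> le_la le_mu; case: (part_subP mu la) => [sub_ml|nsub]; last first.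
  have [j lt_j] : exists j, (part la j < part mu j)%N.
    apply/not_existsP => none; apply: nsub => j.
    by rewrite leqNgt; apply/negP; apply: none.
  have lt_jn : (j < n)%N.
    by rewrite (leq_trans _ le_mu) // -part_pos (leq_ltn_trans _ lt_j).
  rewrite /skew_g ifF; last by apply/negP => /part_subP.
  by rewrite /skew_wt (bigD1 (Ordinal lt_jn)) //= {1}/roww lt_j mul0r.
rewrite (skew_gE_sub sub_ml) -(subnK le_la); elim: (n - _)%N => // k ->.
rewrite addSn /skew_wt big_ord_recr /= {2}/roww (part_default (leq_addl k (size la))).
have := sub_ml (k + size la)%N; rewrite (part_default (leq_addl k (size la))) leqn0.
by move=> /eqP ->; rewrite mulr1.
Qed.

(** * The branching rule *)

(** The transition matrix over R has to be compared with the one over the polynomial ring in which y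
    is a variable. *)
Lemma ser_map (R S : comNzRingType) (h : {rmorphism R -> S}) (a b : R) n j k e :
  h (ser a b n j k e) = ser (h a) (h b) n j k e.
Proof.
have sh_map (f : nat -> R) g : h \o f =1 g -> h \o sh f =1 sh g.
  by move=> fg [|e'] /=; rewrite ?rmorph0 // -fg.
have mb_map (f : nat -> R) g : h \o f =1 g -> h \o mb b f =1 mb (h b) g.
  move=> fg e' /=; rewrite /mb rmorphD rmorphM -(fg e') /=; congr (_ + _ * _).
  exact: sh_map.
have dv_map (f : nat -> R) g : h \o f =1 g -> h \o dv a f =1 dv (h a) g.
  move=> fg; apply: dvK => e'; rewrite /= dvE rmorphD rmorphM -(fg e') /=.
  by congr (_ + _ * _); apply: (sh_map (dv a f) (h \o dv a f)).
have iter_map (op : (nat -> R) -> nat -> R) op' i f g :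
    (forall f g, h \o f =1 g -> h \o op f =1 op' g) ->
    h \o f =1 g -> h \o iter i op f =1 iter i op' g.
  by move=> op_map fg; elim: i => //= i IHi; apply: op_map.
apply: (iter_map _ _ _ _ _ sh_map); apply: (iter_map _ _ _ _ _ mb_map).
by apply: (iter_map _ _ _ _ _ dv_map) => e'; rewrite /= /d0 rmorph_nat.
Qed.

Lemma trans_map (R S : comNzRingType) (h : {rmorphism R -> S}) (a b : R) mu nu :
  h (trans a b mu nu) = trans (h a) (h b) mu nu.
Proof.
rewrite /trans /transn -det_map_mx; congr (\det _); apply/matrixP => j i.
by rewrite !mxE ser_map.
Qed.

(** The identity G(y) M = M S(y), freed from the auxiliary [n] and [t], which are taken large enough
    for the support of both sides. *)
Lemma skew_g_trans (R : comNzRingType) (al be y : R) mu nu d : (psize nu <= d)%N ->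
  \sum_(la <- plist d) skew_g al be la mu y * trans (- al) (- be) la nu =
  \sum_(ka <- plist d) trans (- al) (- be) mu ka * strip y nu ka.
Proof.
move=> nu_d; pose n := maxn (size mu) d; pose t := (part mu 0 + part nu 0 + n + d).+1.
have d_n : (d <= n)%N by apply: leq_maxr.
have mu_n : (size mu <= n)%N by apply: leq_maxl.
have nu_n : (size nu <= n)%N by apply: leq_trans (size_le_psize nu) (leq_trans nu_d d_n).
have in_box (la : intpart) : (psize la <= d)%N -> la \in pbox n t.
  move=> la_d; rewrite mem_pbox (leq_trans (size_le_psize la)) ?(leq_trans la_d) //=.
  by rewrite (leq_trans (part_le_psize la 0)) // (leq_trans la_d) // /t; lia.
have trans_d la : trans (- al) (- be) la nu != 0 -> (psize la <= d)%N.
  by move=> nz; rewrite (leq_trans (unitri_le (trans_unitri _ _) nz)).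
have strip_d ka : strip y nu ka != 0 -> (psize ka <= d)%N.
  by move/strip_neq0/hstrip_le => le_ka; apply: leq_trans nu_d.
transitivity (\sum_(la <- pbox n t) skew_g al be la mu y * trans (- al) (- be) la nu).
  apply: eq_sum_supp; rewrite ?plist_uniq ?pbox_uniq // => la nz;
    [apply: mem_plist|apply: in_box]; apply: trans_d;
    by apply: contraNneq nz => ->; rewrite mulr0.
transitivity (\sum_(ka <- pbox n t) trans (- al) (- be) mu ka * strip y nu ka); last first.
  apply: eq_sum_supp; rewrite ?plist_uniq ?pbox_uniq // => ka nz;
    [apply: in_box|apply: mem_plist]; apply: strip_d;
    by apply: contraNneq nz => ->; rewrite mulr0.
have := @skew_transition R al be y n t mu nu nu_n.
move=> /(_ ltac:(rewrite /t; lia) ltac:(rewrite /t; lia)) key.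
transitivity (\sum_(la <- pbox n t) skew_wt n al be y la mu * transn (- al) (- be) n la nu).
  apply: eq_big_seq => la; rewrite mem_pbox => /andP [la_n _].
  by rewrite (@skew_gE _ _ _ _ n) // transnE.
rewrite key; apply: eq_big_seq => ka; rewrite mem_pbox => /andP [ka_n _].
by rewrite transnE // strip_wtE.
Qed.

Lemma skew_g_neq0 (R : comNzRingType) (a b y : R) la mu :
  skew_g a b la mu y != 0 -> (psize mu <= psize la)%N.
Proof.
rewrite /skew_g; case: part_subP => [sub_ml _|_]; last by rewrite eqxx.
by case: (psize_contained sub_ml) => [->|/ltnW].
Qed.

Section Branching.
Variables (R : comNzRingType) (al be : R) (n : nat).
Let K := trans (- al) (- be).
Let X := kinv K.
Let K_tri : unitri K := trans_unitri _ _.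
Let X_tri : unitri X := kinv_unitri _.
Local Notation x := ('X_ord_max : {mpoly R[n.+1]}).
Local Notation G la mu := (skew_g al%:MP be%:MP la mu x).

(* The kernels of multiplication by 1 / (1 - x y) on Schur functions and on
   Grothendieck functions are conjugate under the transition matrix. *)
Lemma strip_kinv (ka la : intpart) :
  \sum_(nu <- plist (psize la)) strip x nu ka * (X nu la)%:MP =
  \sum_(mu <- plist (psize la)) (X ka mu)%:MP * G la mu.
Proof.
set s := plist (psize la).
have X_le nu : X nu la != 0 -> (psize nu <= psize la)%N by apply: unitri_le.
(* Insert X K = 1 on the left, replace K S by G K, and cancel K X = 1 on the right. *)
transitivity (\sum_(nu <- s) \sum_(mu <- s) (X ka mu)%:MP *
   (\sum_(pi <- s) (K mu pi)%:MP * strip x nu pi) * (X nu la)%:MP).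
  apply: eq_bigr => nu _; have [->|/X_le nu_la] := eqVneq (X nu la) 0.
    by rewrite mpolyC0 mulr0 big1 // => mu _; rewrite mulr0.
  rewrite -mulr_suml; congr (_ * _).
  under eq_bigr do rewrite mulr_sumr.
  rewrite exchange_big /=.
  transitivity (\sum_(pi <- s) (ka == pi)%:R * strip x nu pi).
    have [st0|/strip_neq0/hstrip_le ka_nu] := eqVneq (strip x nu ka) 0.
      rewrite st0 big1 // => pi _; case: eqP => [<-|_]; last by rewrite mul0r.
      by rewrite st0 mulr0.
    rewrite (sum_delta (la := ka)) ?plist_uniq ?eqxx ?mul1r //.
      by rewrite mem_plist // (leq_trans ka_nu).
    by move=> pi; rewrite eq_sym => /negPf ->; rewrite mul0r.
  apply: eq_bigr => pi _; under eq_bigr do rewrite mulrA.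
  rewrite -mulr_suml; have [->|/strip_neq0/hstrip_le pi_nu] := eqVneq (strip x nu pi) 0.
    by rewrite !mulr0.
  congr (_ * _); under eq_bigr do rewrite -mpolyCM.
  by rewrite -rmorph_sum /= kinvK ?(leq_trans pi_nu) // rmorph_nat.
rewrite exchange_big /=; apply: eq_bigr => mu _.
under eq_bigr do rewrite -mulrA.
rewrite -mulr_sumr; congr (_ * _).
transitivity (\sum_(nu <- s) \sum_(pi <- s) G pi mu * ((K pi nu)%:MP * (X nu la)%:MP)).
  apply: eq_bigr => nu _; have [->|/X_le nu_la] := eqVneq (X nu la) 0.
    by rewrite mpolyC0 mulr0 big1 // => pi _; rewrite !mulr0.
  under [RHS]eq_bigr do rewrite mulrA.
  rewrite -mulr_suml; congr (_ * _).
  have KE pi ro : (K pi ro)%:MP_[n.+1] = trans (- al%:MP) (- be%:MP) pi ro.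
    by rewrite /K (trans_map (@mpolyC n.+1 R)) /= !mpolyCN.
  under eq_bigr do rewrite KE.
  by under [RHS]eq_bigr do rewrite KE; rewrite skew_g_trans.
rewrite exchange_big /=.
transitivity (\sum_(pi <- s) G pi mu * (pi == la)%:R).
  apply: eq_bigr => pi _; rewrite -mulr_sumr; congr (_ * _).
  under eq_bigr do rewrite -mpolyCM.
  by rewrite -rmorph_sum /= kinvKV // rmorph_nat.
rewrite (sum_delta (la := la)) ?plist_uniq ?mem_plist ?eqxx ?mulr1 //.
by move=> pi /negPf ->; rewrite mulr0.
Qed.

(** Branch the Schur polynomials in g_la, move the strips across X by [strip_kinv], and collect the
    g_mu. *)
Lemma dualpoly_branching la :
  dualpoly al be la n.+1 = \sum_(mu <- plist (psize la)) mwiden (dualpoly al be mu n) * G la mu.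
Proof.
set s := plist (psize la).
transitivity (\sum_(ka <- s) mwiden (spoly R n ka) * \sum_(nu <- s) strip x nu ka * (X nu la)%:MP).
  under [RHS]eq_bigr do rewrite mulr_sumr.
  rewrite exchange_big /=; apply: eq_bigr => nu _.
  under [RHS]eq_bigr do rewrite mulrA.
  rewrite -mulr_suml -mul_mpolyC mulrC -/K -/(X nu la).
  have [->|nz] := eqVneq (X nu la) 0; first by rewrite mpolyC0 !mulr0.
  congr (_ * _); apply: eq_sum_supp; rewrite ?plist_uniq // => ka st_neq0; apply: mem_plist.
    apply: hstrip_le; apply: (@strip_neq0 _ x).
    by apply: contraNneq st_neq0 => ->; rewrite mulr0.
  apply: leq_trans (unitri_le X_tri nz); apply: hstrip_le; apply: (@strip_neq0 _ x).
  by apply: contraNneq st_neq0 => ->; rewrite mulr0.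
under eq_bigr do rewrite strip_kinv mulr_sumr.
rewrite exchange_big /=; apply: eq_bigr => mu _.
under eq_bigr do rewrite mulrA.
rewrite -mulr_suml; have [->|/skew_g_neq0 mu_la] := eqVneq (G la mu) 0; first by rewrite !mulr0.
congr (_ * _); rewrite /dualpoly rmorph_sum /=.
under [RHS]eq_bigr do rewrite mwidenZ -mul_mpolyC mulrC -/K -/(X _ _).
apply: eq_sum_supp; rewrite ?plist_uniq // => ka nz; apply: mem_plist.
  apply: leq_trans mu_la; apply: (unitri_le X_tri).
  by apply: contraNneq nz => X0; rewrite X0 mpolyC0 mulr0.
by apply: (unitri_le X_tri); apply: contraNneq nz => X0; rewrite X0 mpolyC0 mulr0.
Qed.

End Branching.

Local Open Scope classical_set_scope.
Local Open Scope ring_scope.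

Theorem theorem8p6 (la : intpart) (n : nat) :
  dual_grothendieck alpha beta la n.+1 =
  \sum_(mu \in [set: intpart])
    mwiden (dual_grothendieck alpha beta mu n) *
    skew_g alpha%:MP beta%:MP la mu 'X_ord_max.
Proof.
rewrite (fsum_seq (plist_uniq (psize la))) => [|mu nz]; last first.
  apply/mem_plist/(@skew_g_neq0 {mpoly {mpoly int[2]}[n.+1]} alpha%:MP beta%:MP 'X_ord_max).
  by apply: contraNneq nz => ->; rewrite mulr0.
rewrite dual_grothendieckE [LHS]dualpoly_branching.
by apply: eq_bigr => mu _; rewrite dual_grothendieckE.
Qed.
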